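(* Let $P=(p_1,\dots,p_N)$ be a polynomial map $\mathbb{C}^N\to\mathbb{C}^N$ (each $p_j\in\mathbb{C}[x_1,\dots,x_N]$), and regard $P$ as a map on the set $\mathcal{C}$ of commuting matrix $N$-tuples by evaluation. The following are equivalent: (1) For every $n$, every commuting tuple $X\in\mathcal{C}\cap\mathcal{M}_n(\mathbb{C})^N$ and every $H\in\mathcal{M}_n(\mathbb{C})^N$ such that $\begin{pmatrix}X&H\\0&X\end{pmatrix}\in\mathcal{C}$, the equality $DP(X)[H]=0$ implies $H=0$. (2) $P$ is injective on $\mathcal{C}$. (3) $P$ is a bijection of $\mathcal{C}$ onto itself. (4) $P^{-1}$ exists and is given by a (commutative) polynomial map.
   Context: $\mathcal{M}_n(\mathbb{C})$ denotes the $n\times n$ complex matrices; $\mathcal{C}=\bigcup_{n\ge1}\{(X_1,\dots,X_N)\in\mathcal{M}_n(\mathbb{C})^N: X_iX_j=X_jX_i\ \forall i,j\}$ is the set of commuting matrix $N$-tuples, which is closed under direct sums and simultaneous similarity. A commutative polynomial is evaluated on a commuting tuple by substitution (well defined since the entries commute), and $P$ maps $\mathcal{C}\cap\mathcal{M}_n(\mathbb{C})^N$ into itself. Block matrices of tuples are formed coordinatewise. The derivative is defined by $P\begin{pmatrix}X&H\\0&X\end{pmatrix}=\begin{pmatrix}P(X)&DP(X)[H]\\0&P(X)\end{pmatrix}$, i.e. $DP(X)[H]$ is the upper-right block of $P\begin{pmatrix}X&H\\0&X\end{pmatrix}$. *)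

(* Defs.v *)
From HB Require Import structures.
From mathcomp Require Import all_boot all_order all_algebra.
Set Implicit Arguments. Unset Strict Implicit. Unset Printing Implicit Defensive.
Import GRing.Theory Num.Theory.
Local Open Scope ring_scope.

(* Commutative polynomials in N variables x_0..x_{N-1} with coefficients in F,
   represented by (non-unique) expression trees.  Every element of
   F[x_1,...,x_N] is represented, and evaluation on commuting tuples depends
   only on the polynomial represented. *)
Inductive cpoly (F : Type) (N : nat) : Type :=
| PVar   of 'I_N
| PConst of F
| PAdd   of cpoly F N & cpoly F N
| PMul   of cpoly F N & cpoly F N.

Arguments PVar {F N}.
Arguments PConst {F N}.
Arguments PAdd {F N}.
Arguments PMul {F N}.

Definition commuting (F : numClosedFieldType) (N n : nat)
  (X : 'I_N -> 'M[F]_n) : Prop :=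
  forall i j : 'I_N, X i *m X j = X j *m X i.

Fixpoint ceval (F : numClosedFieldType) (N n : nat) (p : cpoly F N)
  (X : 'I_N -> 'M[F]_n) : 'M[F]_n :=
  match p with
  | PVar i => X i
  | PConst c => c%:M
  | PAdd p q => ceval p X + ceval q X
  | PMul p q => ceval p X *m ceval q X
  end.

Definition polymap (F : numClosedFieldType) (N n : nat) (P : 'I_N -> cpoly F N)
  (X : 'I_N -> 'M[F]_n) : 'I_N -> 'M[F]_n :=
  fun j => ceval (P j) X.

Definition blockT (F : numClosedFieldType) (N n : nat)
  (X H : 'I_N -> 'M[F]_n) : 'I_N -> 'M[F]_(n + n) :=
  fun i => block_mx (X i) (H i) 0 (X i).

Definition DP (F : numClosedFieldType) (N n : nat) (P : 'I_N -> cpoly F N)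
  (X H : 'I_N -> 'M[F]_n) : 'I_N -> 'M[F]_n :=
  fun j => ursubmx (polymap P (blockT X H) j).

(* Main.v *)
Require Import Defs.
From HB Require Import structures.
From mathcomp Require Import all_boot all_order all_algebra ring.
From Stdlib Require Import Classical_Prop.
Set Implicit Arguments. Unset Strict Implicit. Unset Printing Implicit Defensive.
Import GRing.Theory Num.Theory.
Local Open Scope ring_scope.

(** (1) implies (2): the difference of two commuting tuples X, Y is a derivative
    direction at X (+) Y, namely the commutator with [[0, 1], [0, 0]].
    (4) implies (1): P cannot distinguish [[X, H], [0, X]] from [[X, 0], [0, X]].

    (2) implies (4): write theta : F[y] -> F[x] for the substitution y_j |-> P_j.
    Injectivity on 2 x 2 matrices makes the Jacobian nonsingular at every point,
    so its determinant is a nonzero constant and F[x] carries derivations D_k with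
    D_k (theta f) = theta (df / dy_k).  Injectivity on points makes theta
    birational, since a generic point with a conjugate x_i could be specialized to
    two points of the same fibre.  Finally, x_i = theta a / theta d has a trivial
    denominator: if a prime p of F[x] divides theta d, some D_k p is prime to p, so
    no nonzero polynomial independent of y_k contracts from (p); hence the
    contraction of (p) to F[y] is generated by one q, which divides both a and d,
    and the fraction can be reduced. *)

(** * Unique factorization *)

Section Factorization.
Variable R : idomainType.

Definition dvdr (a b : R) : Prop := exists c, b = c * a.

Definition prime_elt (p : R) : Prop :=
  [/\ p != 0, p \isn't a GRing.unit
    & forall a b, dvdr p (a * b) -> dvdr p a \/ dvdr p b].

Definition prime_prod (s : seq R) (a : R) : Prop :=
  (forall p, p \in s -> prime_elt p) /\
  exists2 u, u \is a GRing.unit & a = u * \prod_(p <- s) p.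

(** Factors are asked to be prime rather than irreducible, so that existence of a factorization
    already forces its uniqueness up to units. *)
Definition factorial_ring : Prop :=
  forall a, a != 0 -> exists s, prime_prod s a.

Lemma unit_neq0 (u : R) : u \is a GRing.unit -> u != 0.
Proof. by apply: contraTneq => ->; rewrite unitr0. Qed.

Lemma dvdrr a : dvdr a a.
Proof. by exists 1; rewrite mul1r. Qed.

Lemma dvdr0 a : dvdr a 0.
Proof. by exists 0; rewrite mul0r. Qed.

Lemma dvdr_mull a b c : dvdr a b -> dvdr a (c * b).
Proof. by case=> d ->; exists (c * d); rewrite mulrA. Qed.

Lemma dvdr_mulr a b c : dvdr a b -> dvdr a (b * c).
Proof. by rewrite mulrC; apply: dvdr_mull. Qed.

Lemma dvdr_trans b a c : dvdr a b -> dvdr b c -> dvdr a c.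
Proof. by move=> ab [d ->]; apply: dvdr_mull. Qed.

Lemma dvdrD a b c : dvdr a b -> dvdr a c -> dvdr a (b + c).
Proof. by case=> d -> [e ->]; exists (d + e); rewrite mulrDl. Qed.

Lemma dvdrN a b : dvdr a b -> dvdr a (- b).
Proof. by case=> d ->; exists (- d); rewrite mulNr. Qed.

Lemma dvdrB a b c : dvdr a b -> dvdr a c -> dvdr a (b - c).
Proof. by move=> ab ac; apply: dvdrD => //; apply: dvdrN. Qed.

Lemma dvdr_unit a u : u \is a GRing.unit -> dvdr a u -> a \is a GRing.unit.
Proof. by move=> uu [c e]; move: uu; rewrite e unitrM => /andP[]. Qed.

Lemma prime_not_dvd_unit p u :
  prime_elt p -> u \is a GRing.unit -> ~ dvdr p u.
Proof. by case=> _ pu _ uu /(dvdr_unit uu); apply/negP. Qed.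

Lemma prime_dvd_prod p s :
  prime_elt p -> dvdr p (\prod_(q <- s) q) -> exists2 q, q \in s & dvdr p q.
Proof.
move=> pp; elim: s => [|q s IHs].
  by rewrite big_nil => /(prime_not_dvd_unit pp (unitr1 R)).
rewrite big_cons; case: (pp) => _ _ /[apply] -[pq|/IHs[q' qs pq']].
  by exists q; rewrite ?mem_head.
by exists q' => //; rewrite inE qs orbT.
Qed.

Lemma prime_prodM s t a b :
  prime_prod s a -> prime_prod t b -> prime_prod (s ++ t) (a * b).
Proof.
move=> [sp [u uu ->]] [tp [v vu ->]]; split.
  by move=> p; rewrite mem_cat => /orP[/sp|/tp].
by exists (u * v); rewrite ?unitrM ?uu // big_cat /= mulrACA.
Qed.

Lemma prime_assoc p q : prime_elt p -> prime_elt q -> dvdr p q ->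
  exists2 u, u \is a GRing.unit & q = u * p.
Proof.
move=> [p0 pu pP] [q0 qu qP] [c qE]; exists c => //.
have := dvdrr q; rewrite {2}qE => /qP[[d cE]|qp].
  have dp1 : d * p = 1.
    by apply: (mulIf q0); rewrite mul1r mulrAC -cE -qE.
  by case/negP: pu; apply/unitrP; exists d; split; rewrite // mulrC.
case: qp => d pE; have dc1 : d * c = 1.
  by apply: (mulIf p0); rewrite mul1r -mulrA -qE -pE.
by apply/unitrP; exists d; split; rewrite // mulrC.
Qed.

(** Cancelling a prime shortens the list of factors by one; this length is the measure of several
    inductions below. *)
Lemma prime_prod_divide p s a : prime_elt p -> prime_prod s a -> dvdr p a ->
  exists a' s', [/\ a = p * a', prime_prod s' a' & size s = (size s').+1].
Proof.
move=> pp [sp [u uu ->]]; case: (pp) => _ _ /[apply] -[].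
  by move/(prime_not_dvd_unit pp uu).
move=> /(prime_dvd_prod pp)[q qs /(prime_assoc pp (sp _ qs))[v vu qE]].
exists (u * v * \prod_(p <- rem q s) p), (rem q s); split.
- rewrite (perm_big _ (perm_to_rem qs)) big_cons /= {1}qE.
  by rewrite (mulrC v) !mulrA (mulrC p).
- split; first by move=> r /mem_rem /sp.
  by exists (u * v); rewrite ?unitrM ?uu.
by rewrite size_rem // prednK //; case: (s) qs.
Qed.

Lemma prime_prod_exp_bound p s a n :
  prime_elt p -> prime_prod s a -> dvdr (p ^+ n) a -> (n <= size s)%N.
Proof.
move=> pp; elim: n s a => // n IHn s a sa [c aE].
have pa : dvdr p a by rewrite aE exprS mulrCA; apply/dvdr_mulr/dvdrr.
have [a' [s' [aE' sa' ->]]] := prime_prod_divide pp sa pa.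
apply: (IHn _ a') => //; exists c.
have [p0 _ _] := pp; apply: (mulfI p0).
by rewrite -aE' aE exprS mulrCA.
Qed.

Lemma factorial_ind (Q : R -> Prop) : factorial_ring ->
  (forall u, u \is a GRing.unit -> Q u) ->
  (forall p a, prime_elt p -> a != 0 -> Q a -> Q (p * a)) ->
  forall a, a != 0 -> Q a.
Proof.
move=> fR Qu Qp a /fR[s [sp [u uu ->]]].
elim: s sp => [|p s IHs] sp; first by rewrite big_nil mulr1; apply: Qu.
rewrite big_cons mulrCA; apply: Qp; first by apply: sp; rewrite mem_head.
  rewrite mulf_eq0 negb_or unit_neq0 // prodf_seq_neq0; apply/allP => q qs.
  by case: (sp q) => //; rewrite inE qs orbT.
by apply: IHs => q qs; apply: sp; rewrite inE qs orbT.
Qed.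

Lemma prime_divisor a : factorial_ring -> a != 0 -> a \isn't a GRing.unit ->
  exists2 p, prime_elt p & dvdr p a.
Proof.
move=> fR; move: a; apply: (factorial_ind fR) => [u -> //|p a pp _ _ _].
by exists p => //; apply/dvdr_mulr/dvdrr.
Qed.

End Factorization.

Lemma factorial_field (F : fieldType) : factorial_ring F.
Proof.
move=> a a0; exists [::]; split=> //; exists a; rewrite ?unitfE //.
by rewrite big_nil mulr1.
Qed.

(** * Gauss's lemma: polynomial rings over factorial rings are factorial *)

Section Gauss.
Variable R : idomainType.
Implicit Types (p c : R) (f g h : {poly R}).

Lemma dvdr_polyCP p f : dvdr p%:P f <-> forall i, dvdr p f`_i.
Proof.
split=> [[g ->] i|]; first by exists g`_i; rewrite coefMC.
elim/poly_ind: f => [|f c IHf] pf; first exact: dvdr0.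
apply: dvdrD.
  by apply/dvdr_mulr/IHf => i; have := pf i.+1; rewrite coefD coefMX coefC addr0.
by have [d] := pf 0; rewrite coefD coefMX coefC add0r => /= ->; exists d%:P; rewrite polyCM.
Qed.

Lemma dvdr_polyC_MX p f : dvdr p%:P (f * 'X) <-> dvdr p%:P f.
Proof.
split=> [/dvdr_polyCP pf|]; last exact: dvdr_mulr.
by apply/dvdr_polyCP => i; have := pf i.+1; rewrite coefMX.
Qed.

Lemma dvdr_polyC p c : dvdr p%:P c%:P <-> dvdr p c.
Proof.
split=> [/dvdr_polyCP /(_ 0)|[d ->]]; first by rewrite coefC.
by exists d%:P; rewrite polyCM.
Qed.

(** If [p] divides a product, it divides the product of the constant terms, hence one of them; that
    term is subtracted and ['X] cancelled, which drives the double induction. *)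
Lemma prime_polyC p : prime_elt p -> prime_elt p%:P.
Proof.
move=> [p0 pu pP]; split; first by rewrite polyC_eq0.
  by rewrite poly_unitE size_polyC p0 coefC.
elim/poly_ind => [|f c IHf]; first by left; apply: dvdr0.
elim/poly_ind => [|g d IHg]; first by right; apply: dvdr0.
move=> pfg; have : dvdr p (c * d).
  move/dvdr_polyCP: (pfg) => /(_ 0).
  by rewrite coef0M !coefD !coefMX !coefC /= !add0r.
move=> /pP [pc|pd].
  have pcP : dvdr p%:P c%:P by apply/dvdr_polyC.
  have : dvdr p%:P (f * (g * 'X + d%:P)).
    apply/dvdr_polyC_MX; have := dvdrB pfg (dvdr_mulr (g * 'X + d%:P) pcP).
    by rewrite mulrDl addrK mulrAC.
  case/IHf; last by right.
  by move=> pf; left; apply: dvdrD => //; apply: dvdr_mulr.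
have pdP : dvdr p%:P d%:P by apply/dvdr_polyC.
have : dvdr p%:P ((f * 'X + c%:P) * g).
  apply/dvdr_polyC_MX; have := dvdrB pfg (dvdr_mull (f * 'X + c%:P) pdP).
  by rewrite mulrDr addrK mulrA.
case/IHg; first by left.
by move=> pg; right; apply: dvdrD => //; apply: dvdr_mulr.
Qed.

Definition primitive f := forall p, prime_elt p -> ~ dvdr p%:P f.

Hypothesis fR : factorial_ring R.

(** The primes of [c] are removed one by one: each divides the cofactor of [f], since it is prime in
    [{poly R}] and does not divide [f]. *)
Lemma primitive_cancel f c h :
  primitive f -> c != 0 -> dvdr f (c%:P * h) -> dvdr f h.
Proof.
move=> fP c0; move: c c0 h; apply: (factorial_ind fR) => [u uu|p c pp c0 IHc] h.
  move/(dvdr_mull u^-1%:P); rewrite mulrA -polyCM mulVr //.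
  by rewrite polyC1 mul1r.
rewrite polyCM -mulrA => -[k kE]; apply: IHc.
have [pP0 _ pPP] := prime_polyC pp.
have : dvdr p%:P (k * f) by rewrite -kE; apply/dvdr_mulr/dvdrr.
case/pPP => [[k' k'E]|/(fP _ pp)//].
exists k'; apply: (mulfI pP0); rewrite kE k'E.
by rewrite mulrCA mulrA.
Qed.

(** Each prime of [c] divides [s] or [w] and is cancelled there; [a] and [b] collect what is taken
    from either side. *)
Lemma split_constant c f s w : c != 0 -> c%:P * f = s * w ->
  exists a b s' w',
    [/\ a != 0, b != 0, s = a%:P * s', w = b%:P * w' & f = s' * w'].
Proof.
move=> c0; move: c c0 s w; apply: (factorial_ind fR) => [u uu|p c pp c0 IHc] s w E.
  exists 1, u, s, (u^-1%:P * w); rewrite oner_neq0 unit_neq0 // polyC1 mul1r.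
  split=> //; first by rewrite mulrA -polyCM divrr // mul1r.
  by rewrite mulrCA -E mulrA -polyCM mulVr // mul1r.
have [pP0 _ pPP] := prime_polyC pp; have [p0 _ _] := pp.
have : dvdr p%:P (s * w) by rewrite -E polyCM -mulrA; apply/dvdr_mulr/dvdrr.
case/pPP=> -[v vE]; move: E; rewrite vE polyCM.
  rewrite -mulrA mulrAC [v * w * _]mulrC => /(mulfI pP0) /IHc.
  case=> a [b [s' [w' [a0 b0 -> -> ->]]]].
  exists (p * a), b, s', w'; split=> //; rewrite ?mulf_neq0 //.
  by rewrite polyCM -mulrA mulrC mulrA.
rewrite -mulrA [s * _]mulrA [s * v * _]mulrC => /(mulfI pP0) /IHc.
case=> a [b [s' [w' [a0 b0 -> -> ->]]]].
exists a, (p * b), s', w'; split=> //; rewrite ?mulf_neq0 //.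
by rewrite polyCM -mulrA mulrC mulrA.
Qed.

Lemma primitive_unit c : c != 0 -> primitive c%:P -> c \is a GRing.unit.
Proof.
move=> c0 cP; case: (boolP (c \is a GRing.unit)) => // cu.
have [p pp pc] := prime_divisor fR c0 cu.
by case: (cP p pp); apply/dvdr_polyC.
Qed.

Definition splits f :=
  exists g h, [/\ f = g * h, (1 < size g)%N & (1 < size h)%N].

(** [w] plays the role of a gcd of [f] and [g] over the fraction field of [R]: a nonzero element of
    least degree in the ideal they generate. *)
Lemma min_combination f g : f != 0 ->
  exists w, [/\ w != 0, exists u v, w = u * f + v * g
    & forall u v, (size (u * f + v * g)%R < size w)%N -> u * f + v * g = 0].
Proof.
move=> f0; suff H n (w : {poly R}) : (size w < n)%N -> w != 0 -> (exists u v, w = u * f + v * g) ->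
    exists w, [/\ w != 0, exists u v, w = u * f + v * g
    & forall u v, (size (u * f + v * g)%R < size w)%N -> u * f + v * g = 0].
  by apply: (H (size f).+1 f) => //; exists 1, 0; rewrite mul1r mul0r addr0.
elim: n w => // n IHn w wn w0 wfg.
case: (classic (exists w' : {poly R}, [/\ w' != 0, exists u v, w' = u * f + v * g &
   (size w' < size w)%N])).
  case=> w' [w'0 w'E w's]; apply: (IHn w') => //.
  by apply: leq_trans w's _; rewrite -ltnS.
move=> N; exists w; split=> // u v s.
apply/eqP/negPn/negP => nz; apply: N.
by exists (u * f + v * g); split=> //; exists u, v.
Qed.

(** Up to constants, the gcd [w] of [f] and [g] is a factor of [f]. As [f] does not split, either
    [w] is constant and [f] divides a constant multiple of [h], or [f] is [w] up to constants and
    divides a constant multiple of [g]. Primitivity cancels the constants. *)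
Lemma primitive_prime f : (1 < size f)%N -> primitive f -> ~ splits f ->
  prime_elt f.
Proof.
move=> sf fP nf; have f0 : f != 0 by rewrite -size_poly_gt0 ltnW.
split=> //; first by rewrite poly_unitE gtn_eqF.
move=> g h fgh; have [w [w0 [u [v wE]] wmin]] := min_combination g f0.
have lw0 n : lead_coef w ^+ n != 0 by rewrite expf_neq0 ?lead_coef_eq0.
(* The pseudo-remainder of [k] by [w] stays in the ideal and is shorter than [w], so it vanishes. *)
have dvd_w k : (exists u v, k = u * f + v * g) ->
    exists2 c, c != 0 & exists s, c%:P * k = s * w.
  move=> [u' [v' kE]]; exists (lead_coef w ^+ scalp k w) => //.
  exists (k %/ w)%R.
  rewrite mul_polyC Pdiv.Idomain.divp_eq; suff -> : k %% w = 0 by rewrite addr0.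
  have comb L q : L * k - q * w = (L * u' - q * u) * f + (L * v' - q * v) * g.
    by rewrite kE wE !mulrBl !mulrDr !mulrA opprD addrACA.
  have rE : k %% w = lead_coef w ^+ scalp k w *: k - k %/ w * w.
    by rewrite Pdiv.Idomain.divp_eq addrC addKr.
  by move: (rE); rewrite -mul_polyC comb => ->; apply: wmin; rewrite -comb mul_polyC -rE ltn_modp.
have [c c0 [s sE]] : exists2 c, c != 0 & exists s, c%:P * f = s * w.
  by apply: dvd_w; exists 1, 0; rewrite mul1r mul0r addr0.
have [a [b [s' [w' [a0 b0 _ wE' fE]]]]] := split_constant c0 sE.
have w'0 : w' != 0 by apply: contraNneq w0 => z; rewrite wE' z mulr0.
have s'0 : s' != 0 by apply: contraNneq f0 => z; rewrite fE z mul0r.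
case: (ltnP 1 (size w')) => sw'; last first.
  right; have [d dE] : exists d, w' = d%:P.
    by exists w'`_0; apply: size1_polyC.
  have d0 : d != 0 by move: w'0; rewrite dE polyC_eq0.
  apply: (primitive_cancel (c := b * d)) => //; first by rewrite mulf_neq0.
  rewrite polyCM -dE -wE' wE mulrDl; apply: dvdrD.
    by rewrite mulrAC; apply/dvdr_mull/dvdrr.
  by rewrite -mulrA; apply: dvdr_mull.
left; have [d dE] : exists d, s' = d%:P.
  exists s'`_0; apply: size1_polyC; rewrite leqNgt; apply/negP => ss'.
  by apply: nf; exists s', w'.
have d0 : d != 0 by move: s'0; rewrite dE polyC_eq0.
have du : d \is a GRing.unit.
  apply: primitive_unit => // p pp; rewrite -dE => ps.
  by apply: (fP p pp); rewrite fE; apply: dvdr_mulr.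
have [c' c'0 [t tE]] : exists2 c, c != 0 & exists s, c%:P * g = s * w.
  by apply: dvd_w; exists 0, 1; rewrite mul1r mul0r add0r.
apply: (primitive_cancel (c := c')) => //; rewrite tE wE'.
have -> : w' = d^-1%:P * f by rewrite fE dE mulrA -polyCM mulVr // mul1r.
by rewrite !mulrA; apply/dvdr_mull/dvdrr.
Qed.

(** Induction on the number of prime factors of the leading coefficient: each prime pulled out of
    [f] is pulled out of it as well. *)
Lemma primitive_part f : f != 0 ->
  exists c f', [/\ c != 0, f = c%:P * f' & primitive f'].
Proof.
move=> f0; have [|s] := fR (a := lead_coef f); first by rewrite lead_coef_eq0.
move: {2}(size s).+1 (ltnSn (size s)) => n.
elim: n s f f0 => // n IHn s f f0 sn sf.
case: (classic (exists2 p, prime_elt p & dvdr p%:P f)) => [[p pp [g gE]]|N]; last first.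
  exists 1, f; rewrite oner_neq0 mul1r; split=> // p pp pf.
  by apply: N; exists p.
have [p0 _ _] := pp.
have g0 : g != 0 by apply: contraNneq f0 => z; rewrite gE z mul0r.
have lE : lead_coef f = lead_coef g * p by rewrite gE lead_coefM lead_coefC.
have [|l' [s' [E s'l ss']]] := prime_prod_divide pp sf.
  by exists (lead_coef g).
move: E; rewrite lE mulrC => /(mulfI p0) E; rewrite -E in s'l.
have [|c [f' [c0 gE' fP]]] := IHn s' g g0 _ s'l.
  by rewrite -ltnS -ss'.
exists (p * c), f'; split=> //; first by rewrite mulf_neq0.
by rewrite gE gE' polyCM mulrC mulrA.
Qed.

Lemma prime_prod_polyC s c : prime_prod s c ->
  prime_prod (map polyC s) c%:P.
Proof.
move=> [sp [u uu ->]]; split=> [q /mapP[p /sp pp ->]|]; first exact: prime_polyC.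
exists u%:P; first by rewrite poly_unitE size_polyC unit_neq0 // coefC.
by rewrite polyCM big_map rmorph_prod.
Qed.

(** Induction on the size: the primitive part of [f] is constant, or prime, or a product of two
    factors of smaller degree. *)
Lemma factorial_poly : factorial_ring {poly R}.
Proof.
move=> f; move: {2}(size f) (leqnn (size f)) => n.
elim: n f => [|n IHn] f fn f0.
  by move: fn; rewrite leqNgt size_poly_gt0 f0.
have [c [f' [c0 fE fP]]] := primitive_part f0.
have [s sc] := fR c0.
suff [t tf] : exists t, prime_prod t f'.
  by exists (map polyC s ++ t); rewrite fE; apply: prime_prodM => //; apply: prime_prod_polyC.
have f'0 : f' != 0 by apply: contraNneq f0 => z; rewrite fE z mulr0.
have sf' : size f' = size f by rewrite fE size_Cmul.
case: (ltnP 1 (size f')) => s1; last first.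
  have f'E := size1_polyC s1; have c'0 : f'`_0 != 0.
    by move: f'0; rewrite {1}f'E polyC_eq0.
  rewrite f'E; have [t tc] := fR c'0.
  by exists (map polyC t); apply: prime_prod_polyC.
case: (classic (splits f')) => [[g [h [E sg sh]]]|ns]; last first.
  exists [:: f']; split=> [q|].
    by rewrite inE => /eqP ->; apply: primitive_prime.
  by exists 1; rewrite ?unitr1 // big_seq1 mul1r.
have g0 : g != 0 by rewrite -size_poly_gt0 ltnW.
have h0 : h != 0 by rewrite -size_poly_gt0 ltnW.
have := size_mul g0 h0; rewrite -E sf' => sE.
have [|sg' gp] := IHn g _ g0.
  rewrite -ltnS; apply: leq_trans fn; rewrite sE.
  by case: (size h) sh => [|[|k]] // _; rewrite !addnS ltnS leq_addr.
have [|sh' hp] := IHn h _ h0.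
  rewrite -ltnS; apply: leq_trans fn; rewrite sE.
  by case: (size g) sg => [|[|k]] // _; rewrite !addSn ltnS leq_addl.
by exists (sg' ++ sh'); rewrite E; apply: prime_prodM.
Qed.

End Gauss.

(** * Specialization of generic points *)

Section ClosedFieldPoly.
Variable F : closedFieldType.
Implicit Types p q : {poly F}.

Lemma dvdp_exp_roots p q n : p != 0 -> (size p <= n.+1)%N ->
  (forall z, root p z -> root q z) -> p %| q ^+ n.
Proof.
move=> p0 sp pq; have [s pE] := closed_field_poly_normal p.
have lp0 : lead_coef p != 0 by rewrite lead_coef_eq0.
have sE : size p = (size s).+1.
  by rewrite pE size_scale // size_prod_XsubC.
have {}pq z : z \in s -> root q z.
  by move=> zs; apply: pq; rewrite pE rootZ // root_prod_XsubC.
rewrite pE dvdpZl //.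
apply: (@dvdp_trans _ (q ^+ size s)); last first.
  by apply: dvdp_exp2l; rewrite -ltnS -sE.
elim: s pq {pE sE} => [|z s IHs] pq; first by rewrite big_nil dvd1p.
rewrite big_cons exprS dvdp_mul ?dvdp_XsubCl ?pq ?mem_head //.
by apply: IHs => y ys; rewrite pq // inE ys orbT.
Qed.

(** Existence of a root of [p] off [q] is reduced to a nondivisibility, which a nonzero coefficient
    of a remainder can certify; [n] bounds the degree of [p]. *)
Lemma exists_nonroot_off p q n : p != 0 -> (size p <= n.+1)%N ->
  ~~ (p %| q ^+ n) -> exists2 z, root p z & q.[z] != 0.
Proof.
move=> p0 sp npq; apply: NNPP => N; case/negP: npq.
apply: dvdp_exp_roots => // z pz; case: (boolP (root q z)) => // qz.
by case: N; exists z.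
Qed.

End ClosedFieldPoly.

Lemma exists_nonroot (F : numClosedFieldType) (p : {poly F}) :
  p != 0 -> exists z, p.[z] != 0.
Proof.
move=> p0; apply: NNPP => N.
have := @max_poly_roots _ p [seq i%:R | i <- iota 0 (size p)] p0.
rewrite size_map size_iota ltnn => H; suff: false by []; apply: H; last first.
  by rewrite map_inj_uniq ?iota_uniq //; apply: (mulrIn (oner_neq0 _)).
by apply/allP => z _; case: (boolP (root p z)) => // pz; case: N; exists z.
Qed.

Lemma deriv_eq0 (R : idomainType) (p : {poly R}) :
  [pchar R] =i pred0 -> p^`() = 0 -> p = (p`_0)%:P.
Proof.
move=> charR dp0; apply: size1_polyC; apply/leq_sizeP => -[//|j] _; apply/eqP.
have := congr1 (fun p : {poly R} => p`_j) dp0.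
rewrite coef_deriv coef0 => /eqP.
by rewrite -mulr_natr mulf_eq0 (iffLR (GRing.pcharf0P R) charR) orbF.
Qed.

Lemma map_poly_neq0P (S T : nzRingType) (f : {rmorphism S -> T}) (h : {poly S}) :
  map_poly f h != 0 -> exists i, f h`_i != 0.
Proof.
move=> h0; exists (size (map_poly f h)).-1.
by rewrite -coef_map -[_`_ _]/(lead_coef _) lead_coef_eq0.
Qed.

Section Specialization.
Variables (F : numClosedFieldType) (L : fieldType) (R : idomainType).
Variables (phi : {rmorphism R -> L}) (e : L).
Hypothesis charL : [pchar L] =i pred0.

(** Says that [chi] factors through the image of [phi], that is, defines a homomorphism on that
    subring of [L]. *)
Definition specializes (chi : R -> F) := forall z, phi z = 0 -> chi z = 0.

Local Notation ev h := ((map_poly phi h).[e]).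

(* The minimal polynomial of [e] over the fraction field of the image of [phi],
   with denominators cleared. *)
Definition minimal_relation (m : {poly R}) :=
  [/\ ev m = 0, phi (lead_coef m) != 0
    & forall h, ev h = 0 -> (size h < size m)%N -> map_poly phi h = 0].

Lemma minimal_relation_exists h : ev h = 0 -> map_poly phi h != 0 ->
  exists m, minimal_relation m.
Proof.
move: {2}(size h).+1 (ltnSn (size h)) => n.
elim: n h => // n IHn h hn h0 hn0.
case: (classic (exists g, [/\ ev g = 0, (size g < size h)%N & map_poly phi g != 0])).
  case=> g [g0 gh gn0]; apply: (IHn g) => //.
  exact: leq_trans gh _.
move=> N; have min g : ev g = 0 -> (size g < size h)%N -> map_poly phi g = 0.
  by move=> g0 gs; case: (eqVneq (map_poly phi g) 0) => // gn0; case: N; exists g.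
exists h; split=> //; apply/negP => /eqP l0.
have hz : h != 0 by apply: contraNneq hn0 => ->; rewrite rmorph0.
(* If [phi] killed the leading coefficient, dropping that term would give a shorter polynomial with
   the same image. *)
pose g := h - lead_coef h *: 'X^((size h).-1).
have gE : map_poly phi g = map_poly phi h.
  by rewrite rmorphB /= map_polyZ /= l0 scale0r subr0.
suff gh : (size g < size h)%N.
  by case/eqP: hn0; rewrite -gE; apply: min => //; rewrite gE.
have sh : (0 < size h)%N by rewrite size_poly_gt0.
rewrite -[X in (_ < X)%N](prednK sh) ltnS; apply/leq_sizeP => j.
rewrite leq_eqVlt => /orP[/eqP <-|jh].
  by rewrite coefB coefZ coefXn eqxx mulr1 subrr.
rewrite coefB coefZ coefXn gtn_eqF // mulr0 subr0 nth_default //.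
by rewrite -(prednK sh).
Qed.

(** By minimality the pseudo-remainder of [h] by [m] has its coefficients in the kernel of [phi], so
    [chi] kills it. Hence [e] may be sent to any root [c] of the specialized [m]. *)
Lemma specialize_root m (chi : {rmorphism R -> F}) c h :
  minimal_relation m -> specializes chi -> chi (lead_coef m) != 0 ->
  root (map_poly chi m) c -> ev h = 0 -> (map_poly chi h).[c] = 0.
Proof.
move=> [m0 lm mmin] sp lc /eqP cm h0.
have mn0 : m != 0 by apply: contraNneq lm => ->; rewrite lead_coef0 rmorph0.
have dE := Pdiv.Idomain.divp_eq h m.
have r0 : map_poly phi (h %% m) = 0.
  apply: mmin; last by rewrite ltn_modp.
  have := congr1 (fun h => ev h) dE.
  by rewrite rmorphD rmorphM /= map_polyZ hornerZ hornerD hornerM m0 h0 !mulr0 add0r => <-.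
have rc0 : map_poly chi (h %% m) = 0.
  apply/polyP => i; rewrite coef_map coef0; apply: sp.
  by rewrite -coef_map r0 coef0.
have := congr1 (fun h => (map_poly chi h).[c]) dE.
rewrite rmorphD rmorphM /= map_polyZ hornerZ hornerD hornerM cm rc0 horner0 addr0 mulr0.
by move/eqP; rewrite mulf_eq0 rmorphXn expf_eq0 (negPf lc) andbF /= => /eqP.
Qed.

Lemma dvdp_map_small m (chi : {rmorphism R -> F}) (q : {poly F}) :
  chi (lead_coef m) != 0 -> (size q < size m)%N -> map_poly chi m %| q -> q = 0.
Proof.
move=> lc sq mq; apply: contraTeq sq => q0.
by have := dvdp_leq q0 mq; rewrite size_map_poly_id0 // leqNgt.
Qed.

Lemma dvdp_map_modp m (chi : {rmorphism R -> F}) h :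
  map_poly chi m %| map_poly chi h -> map_poly chi m %| map_poly chi (h %% m).
Proof.
move=> mh; have -> : h %% m = lead_coef m ^+ scalp h m *: h - h %/ m * m.
  by rewrite Pdiv.Idomain.divp_eq addrC addKr.
rewrite rmorphB rmorphM /= dvdp_sub ?dvdp_mulIr //.
by rewrite map_polyZ -mul_polyC dvdp_mull.
Qed.

Lemma specialize_transcendental (chi : {rmorphism R -> F}) c h :
  (forall h, ev h = 0 -> map_poly phi h = 0) -> specializes chi ->
  ev h = 0 -> (map_poly chi h).[c] = 0.
Proof.
move=> tr sp /tr h0; suff -> : map_poly chi h = 0 by rewrite horner0.
by apply/polyP => i; rewrite coef_map coef0; apply: sp; rewrite -coef_map h0 coef0.
Qed.

Lemma algebraic_or_transcendental :
  (exists m, minimal_relation m) \/ (forall h, ev h = 0 -> map_poly phi h = 0).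
Proof.
case: (classic (exists2 h, ev h = 0 & map_poly phi h != 0)) => [[h]|N].
  by move=> h0 hn0; left; apply: minimal_relation_exists hn0.
by right=> h h0; case: (eqVneq (map_poly phi h) 0) => // hn0; case: N; exists h.
Qed.

(** In the algebraic case [r] is the leading coefficient of [m] times a coefficient of [g ^+ n]
    modulo [m]: if [chi r] is nonzero, the specialized [m] does not divide the specialized [g ^+ n],
    so one of its roots avoids [g]. In the transcendental case any nonroot of the specialized [g]
    will do. *)
Lemma extend_specialization g : ev g != 0 ->
  exists2 r, phi r != 0 & forall chi : {rmorphism R -> F},
    specializes chi -> chi r != 0 -> exists2 c,
      forall h, ev h = 0 -> (map_poly chi h).[c] = 0
      & (map_poly chi g).[c] != 0.
Proof.
move=> g0; have [[m mm]|tr] := algebraic_or_transcendental; last first.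
  have [|i gi] := @map_poly_neq0P _ _ phi g.
    by apply: contraNneq g0 => ->; rewrite horner0.
  exists g`_i => // chi sp gci.
  have [|c cg] := @exists_nonroot F (map_poly chi g).
    by apply: contraNneq gci => z; rewrite -coef_map z coef0.
  exists c => // h h0; exact: specialize_transcendental.
have [m0 lm mmin] := mm.
pose n := size m; pose G := g ^+ n.
have mn0 : m != 0 by apply: contraNneq lm => ->; rewrite lead_coef0 rmorph0.
have dE := Pdiv.Idomain.divp_eq G m.
have [|i ri] := @map_poly_neq0P _ _ phi (G %% m).
  suff : ev (G %% m) != 0 by apply: contraNneq => ->; rewrite horner0.
  have := congr1 (fun h => ev h) dE.
  rewrite rmorphD rmorphM /= map_polyZ hornerZ hornerD hornerM m0 mulr0 add0r => <-.
  by rewrite !rmorphXn /= horner_exp mulf_neq0 // expf_neq0.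
exists (lead_coef m * (G %% m)`_i); first by rewrite rmorphM mulf_neq0.
move=> chi sp; rewrite rmorphM mulf_eq0 negb_or => /andP[lc rc].
have sc : size (map_poly chi m) = size m by rewrite size_map_poly_id0.
have mc0 : map_poly chi m != 0 by rewrite -size_poly_gt0 sc size_poly_gt0.
have [||c cm cg] := @exists_nonroot_off _ (map_poly chi m) (map_poly chi g) n mc0.
- by rewrite sc.
- apply: contra rc; rewrite -rmorphXn => /dvdp_map_modp /(dvdp_map_small lc).
  rewrite (leq_ltn_trans (size_poly _ _)) ?ltn_modp // => /(_ isT) z.
  by rewrite -coef_map z coef0.
exists c => // h h0; exact: (specialize_root mm).
Qed.

(** In characteristic zero a derivative vanishing at [e] would, by minimality, make the image of [m]
    constant, hence zero. *)
Lemma minimal_relation_separable m : minimal_relation m -> ev m^`() != 0.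
Proof.
move=> [m0 lm mmin].
have mn0 : m != 0 by apply: contraNneq lm => ->; rewrite lead_coef0 rmorph0.
apply: contra_eqN m0 => /eqP /mmin /(_ (lt_size_deriv mn0)) d0.
have MC : map_poly phi m = ((map_poly phi m)`_0)%:P by rewrite -deriv_map in d0; apply: deriv_eq0.
rewrite MC hornerC; apply: contraNneq lm => z.
have M0 : map_poly phi m = 0 by rewrite MC z.
by rewrite lead_coefE -coef_map M0 coef0.
Qed.

(* If only one root [c] of the specialized minimal polynomial avoided [g], then
   [g ^+ n] and ['X * g ^+ n] would have proportional remainders; this is
   excluded by the nonvanishing of a 2 x 2 minor of the generic remainders, as
   [1] and [e] are independent over the fraction field of the image of [phi]. *)
Lemma extend_specialization_twice g : ev g != 0 ->
  (forall a b, phi b != 0 -> phi b * e != phi a) ->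
  exists2 r, phi r != 0 & forall chi : {rmorphism R -> F},
    specializes chi -> chi r != 0 -> exists c c',
      [/\ c != c', (map_poly chi g).[c] != 0, (map_poly chi g).[c'] != 0
        & forall h, ev h = 0 ->
            (map_poly chi h).[c] = 0 /\ (map_poly chi h).[c'] = 0].
Proof.
move=> g0 e_irr; have [[m mm]|tr] := algebraic_or_transcendental; last first.
  have [|i gi] := @map_poly_neq0P _ _ phi g.
    by apply: contraNneq g0 => ->; rewrite horner0.
  exists g`_i => // chi sp gci.
  have gc0 : map_poly chi g != 0.
    by apply: contraNneq gci => z; rewrite -coef_map z coef0.
  have [c cg] := exists_nonroot gc0.
  have [|c'] := @exists_nonroot F (('X - c%:P) * map_poly chi g).
    by rewrite mulf_neq0 ?polyXsubC_eq0.
  rewrite hornerM !hornerE mulf_eq0 negb_or subr_eq0 => /andP[cc' c'g].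
  exists c, c'; split=> //; first by rewrite eq_sym.
  by move=> h h0; split; apply: specialize_transcendental.
have [m0 lm mmin] := mm; have dm0 := minimal_relation_separable mm.
(* After specialization, a root of [m] off [k] avoids [g] and is simple. *)
pose n := size m; pose k := g * m^`(); pose G := k ^+ n.
have G0 : ev G != 0.
  by rewrite rmorphXn /= horner_exp expf_neq0 // rmorphM hornerM mulf_neq0.
have mn0 : m != 0 by apply: contraNneq lm => ->; rewrite lead_coef0 rmorph0.
pose l0 := lead_coef m ^+ scalp G m; pose l1 := lead_coef m ^+ scalp ('X * G) m.
pose r0 := G %% m; pose r1 := ('X * G) %% m.
have E0 : l0 *: G = G %/ m * m + r0 by apply: Pdiv.Idomain.divp_eq.
have E1 : l1 *: ('X * G) = ('X * G) %/ m * m + r1 by apply: Pdiv.Idomain.divp_eq.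
have evE h l q r : l *: h = q * m + r -> ev r = phi l * ev h.
  move/(congr1 (fun h => ev h)).
  by rewrite rmorphD rmorphM /= map_polyZ hornerZ hornerD hornerM m0 mulr0 add0r => <-.
have ev0 := evE _ _ _ _ E0.
have ev1 : ev r1 = phi l1 * (e * ev G).
  by rewrite (evE _ _ _ _ E1) rmorphM /= map_polyX hornerM hornerX.
have [|i ri] := @map_poly_neq0P _ _ phi r0.
  suff : ev r0 != 0 by apply: contraNneq => ->; rewrite horner0.
  by rewrite ev0 mulf_neq0 // rmorphXn expf_neq0.
have [j rj] : exists j, phi (r0`_i * r1`_j - r1`_i * r0`_j) != 0.
  apply: NNPP => N.
  have rE : phi r0`_i *: map_poly phi r1 = phi r1`_i *: map_poly phi r0.
    apply/polyP => j; rewrite !coefZ !coef_map /= -!rmorphM; apply/eqP.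
    rewrite -subr_eq0 -rmorphB; case: eqVneq => // nz; by case: N; exists j.
  have b0 : phi (r0`_i * l1) != 0.
    by rewrite rmorphM mulf_neq0 // rmorphXn expf_neq0.
  case/negP: (e_irr (r1`_i * l0) _ b0).
  apply/eqP/(mulIf G0); rewrite !rmorphM -!mulrA -ev0 -ev1.
  by rewrite -!hornerZ rE.
exists (lead_coef m * (r0`_i * r1`_j - r1`_i * r0`_j)).
  by rewrite rmorphM mulf_neq0.
move=> chi sp; rewrite rmorphM mulf_eq0 negb_or => /andP[lc rc].
have sc : size (map_poly chi m) = size m by rewrite size_map_poly_id0.
have mc0 : map_poly chi m != 0 by rewrite -size_poly_gt0 sc size_poly_gt0.
have small (r : {poly R}) : (size r < size m)%N -> (size (map_poly chi r) < size m)%N.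
  exact/leq_ltn_trans/size_poly.
have sr0 : (size r0 < size m)%N by rewrite ltn_modp.
have sr1 : (size r1 < size m)%N by rewrite ltn_modp.
have [||c cm ck] := @exists_nonroot_off _ (map_poly chi m) (map_poly chi k) n mc0.
- by rewrite sc.
- apply: contra rc; rewrite -rmorphXn => /dvdp_map_modp /(dvdp_map_small lc (small _ sr0)) z.
  have rz s : chi r0`_s = 0 by rewrite -coef_map z coef0.
  by rewrite rmorphB !rmorphM /= !rz mul0r mulr0 subr0.
have gE z : (map_poly chi k).[z] = (map_poly chi g).[z] * ((map_poly chi m)^`()).[z].
  by rewrite rmorphM hornerM deriv_map.
have [w wE] := factor_theorem _ _ cm.
have w0 : w != 0 by apply: contraNneq mc0 => z; rewrite wE z mul0r.
have sw : (size w <= n.+1)%N.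
  apply: (@leq_trans n) => //; rewrite /n -sc wE.
  by rewrite size_mul ?polyXsubC_eq0 // size_XsubC addn2 leqnSn.
(* If [w] divided the specialized [k ^+ n], then [m] would divide [G * ('X - c)] after
   specialization; [q], the remainder of the latter up to a scalar, would vanish and annihilate the
   minor. *)
have [|c' cw c'k] := @exists_nonroot_off _ w (map_poly chi k) n w0 sw.
  apply: contra rc => wk.
  have {}wk : map_poly chi m %| map_poly chi G * ('X - c%:P).
    by rewrite wE [map_poly chi G]rmorphXn dvdp_mul.
  pose q := chi l0 *: map_poly chi r1 - (c * chi l1) *: map_poly chi r0.
  have q0 : q = 0.
    apply: (dvdp_map_small lc).
      rewrite (leq_ltn_trans (size_polyD _ _)) // size_polyN gtn_max.
      by rewrite !(leq_ltn_trans (size_scale_leq _ _)) ?small.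
    have -> : q = (chi l0 * chi l1) *: (map_poly chi G * ('X - c%:P))
         - (chi l0 *: map_poly chi (('X * G) %/ m)
            - (c * chi l1) *: map_poly chi (G %/ m)) * map_poly chi m.
      have c0 := congr1 (map_poly chi) E0; have c1 := congr1 (map_poly chi) E1.
      move: c0 c1; rewrite !rmorphD !rmorphM /= !map_polyZ rmorphM /= map_polyX => c0 c1.
      have R0 : map_poly chi r0 = (chi l0)%:P * map_poly chi G
          - map_poly chi (G %/ m) * map_poly chi m.
        by rewrite mul_polyC c0 addrC addKr.
      have R1 : map_poly chi r1 = (chi l1)%:P * ('X * map_poly chi G)
          - map_poly chi (('X * G) %/ m) * map_poly chi m.
        by rewrite mul_polyC c1 addrC addKr.
      by rewrite /q -!mul_polyC R0 R1 !polyCM; ring.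
    by rewrite dvdp_sub ?dvdp_mull // -mul_polyC dvdp_mull.
  have qE s : chi l0 * chi r1`_s = c * chi l1 * chi r0`_s.
    apply/eqP; rewrite -subr_eq0; apply/eqP.
    by have := congr1 (fun q : {poly F} => q`_s) q0; rewrite coefB !coefZ !coef_map coef0.
  have l00 : chi l0 != 0 by rewrite rmorphXn expf_neq0.
  apply/eqP/(mulfI l00); move: (qE i) (qE j); rewrite rmorphB !rmorphM mulr0 /=.
  move: (chi l0) (chi l1) (chi r0`_i) (chi r0`_j) (chi r1`_i) (chi r1`_j).
  move=> a b xi xj yi yj Ei Ej.
  transitivity (xi * (a * yj) - (a * yi) * xj); first by ring.
  by rewrite Ei Ej; ring.
exists c, c'; split.
(* A second occurrence of [c] would make it a double root of the specialized [m], where the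
   derivative, and hence [k], vanishes. *)
- apply: contraNneq c'k => cc'; rewrite -cc' in cw *.
  by rewrite gE wE derivM derivXsubC mulr1 hornerD hornerM hornerXsubC subrr
    mulr0 add0r (eqP cw) mulr0.
- by move: ck; rewrite gE mulf_eq0 negb_or => /andP[].
- by move: c'k; rewrite gE mulf_eq0 negb_or => /andP[].
have c'm : root (map_poly chi m) c' by rewrite wE rootM cw.
by move=> h h0; split; apply: (specialize_root mm).
Qed.

End Specialization.

(** The elements are adjoined one by one, with the nonvanishing conditions computed backwards: the
    condition [r1] for the later elements is the [g] that the value chosen for the first one must
    avoid. *)
Lemma extend_specialization_seq (F : numClosedFieldType) (L : fieldType)
    (es : seq L) (R : idomainType) (phi : {rmorphism R -> L}) :
  exists2 r, phi r != 0 & forall chi : {rmorphism R -> F},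
    specializes phi chi -> chi r != 0 ->
    exists (R' : idomainType) (phi' : {rmorphism R' -> L})
           (chi' : {rmorphism R' -> F}) (j : {rmorphism R -> R'}),
      [/\ specializes phi' chi', forall z, phi' (j z) = phi z,
          forall z, chi' (j z) = chi z
        & forall e, e \in es -> exists z, phi' z = e].
Proof.
elim: es R phi => [|e es IHes] R phi.
  exists 1; first by rewrite rmorph1 oner_neq0.
  by move=> chi sp _; exists R, phi, chi, idfun.
pose phi1 : {rmorphism {poly R} -> L} := horner_morph (fun x => mulrC e (phi x)).
have [r1 r1n0 H1] := IHes _ phi1.
have [r rn0 H] := extend_specialization F r1n0.
exists r => // chi sp cr; have [c cP cr1] := H chi sp cr.
pose chi1 : {rmorphism {poly R} -> F} := horner_morph (fun x => mulrC c (chi x)).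
have [R' [phi' [chi' [j [sp' jphi jchi jes]]]]] := H1 chi1 cP cr1.
exists R', phi', chi', (j \o polyC); split=> // [z|z|e'].
- by rewrite /= jphi; apply: horner_morphC.
- by rewrite /= jchi; apply: horner_morphC.
rewrite inE => /orP[/eqP ->|/jes //].
by exists (j 'X); rewrite jphi; apply: horner_morphX.
Qed.

(** * Iterated polynomial rings *)

Section Tower.
Variable F : fieldType.

(** Polynomials in [n] variables, nested so that univariate division, roots and Gauss's lemma apply
    to the last variable. *)
Fixpoint tower (n : nat) : idomainType :=
  if n is m.+1 then {poly tower m} else F.

Fixpoint tconst n : {rmorphism F -> tower n} :=
  if n is m.+1 then polyC \o tconst m : {rmorphism F -> {poly tower m}}
  else idfun.

(* Variable [i] is adjoined at level [i.+1]; junk value 0 when [n <= i]. *)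
Fixpoint tvar n (i : nat) : tower n :=
  if n is m.+1 then (if i == m then 'X else (tvar m i)%:P : {poly tower m})
  else 0.

Fixpoint tmor (S : comNzRingType) (f : {rmorphism F -> S}) (z : nat -> S) n :
    {rmorphism tower n -> S} :=
  if n is m.+1 then horner_morph (fun x => mulrC (z m) (tmor f z m x)) else f.

Lemma tmorS (S : comNzRingType) (f : {rmorphism F -> S}) z n (p : tower n.+1) :
  tmor f z n.+1 p = (map_poly (tmor f z n) p).[z n].
Proof. by []. Qed.

Lemma tmor_const (S : comNzRingType) (f : {rmorphism F -> S}) z n c :
  tmor f z n (tconst n c) = f c.
Proof. by elim: n => //= n IHn; rewrite horner_morphC. Qed.

Lemma tmor_var (S : comNzRingType) (f : {rmorphism F -> S}) z n i :
  (i < n)%N -> tmor f z n (tvar n i) = z i.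
Proof.
elim: n => //= n IHn; rewrite ltnS leq_eqVlt.
case: eqP => [-> _|_ /IHn]; first by rewrite horner_morphX.
by rewrite horner_morphC.
Qed.

Lemma tmor_ext (S : comNzRingType) (f : {rmorphism F -> S}) z z' n :
  (forall i, (i < n)%N -> z i = z' i) -> tmor f z n =1 tmor f z' n.
Proof.
elim: n => // n IHn zz' p; rewrite !tmorS zz' //.
by rewrite (eq_map_poly (IHn _)) // => i /leqW; apply: zz'.
Qed.

Lemma tower_hom_uniq n (S : nzRingType) (g h : {rmorphism tower n -> S}) :
  (forall c, g (tconst n c) = h (tconst n c)) ->
  (forall i, (i < n)%N -> g (tvar n i) = h (tvar n i)) -> g =1 h.
Proof.
elim: n S g h => // n IHn S g h gc gv.
have gX : g 'X = h 'X by have := gv n (ltnSn n); rewrite /= eqxx.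
have gC (a : tower n) : g a%:P = h a%:P.
  apply: (IHn S (g \o polyC) (h \o polyC)) => [c|i in_]; first exact: gc.
  by have := gv i (leqW in_); rewrite /= ltn_eqF.
elim/poly_ind => [|p c IHp]; first by rewrite !rmorph0.
by rewrite !rmorphD !rmorphM /= IHp gX gC.
Qed.

Lemma tmor_comp (S : comNzRingType) (f : {rmorphism F -> S}) z n w m p :
  tmor f z n (tmor (tconst n) w m p) = tmor f (fun i => tmor f z n (w i)) m p.
Proof.
move: p; apply: (tower_hom_uniq (g := tmor f z n \o tmor (tconst n) w m)).
  by move=> c; rewrite /= !tmor_const.
by move=> i im; rewrite /= !tmor_var.
Qed.

Lemma tconst_unit n c : c != 0 -> tconst n c \is a GRing.unit.
Proof. by move=> c0; apply: rmorph_unit; rewrite unitfE. Qed.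

Lemma tower_unitP n u : u \is a GRing.unit -> exists2 c, c != 0 & u = tconst n c.
Proof.
elim: n u => [|n IHn] u; first by rewrite unitfE; exists u.
rewrite poly_unitE => /andP[su /IHn[c c0 uE]]; exists c => //=.
by rewrite -uE; apply: size1_polyC; rewrite (eqP su).
Qed.

Lemma factorial_tower n : factorial_ring (tower n).
Proof.
by elim: n => [|n IHn]; [apply: factorial_field | apply: factorial_poly].
Qed.

(** * Partial derivatives and derivations along a ring map *)

Fixpoint tder n (k : nat) : tower n -> tower n :=
  if n is m.+1 then
    (if k == m then @deriv _ else map_poly (@tder m k)) :
      {poly tower m} -> {poly tower m}
  else fun=> 0.

(** Taken relative to [g], so that composites of a derivation with a substitution are again
    derivations, determined by their values on constants and variables. *)
Definition derivation (R S : nzRingType) (g d : R -> S) :=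
  {morph d : a b / a + b} /\ forall a b, d (a * b) = d a * g b + g a * d b.

Lemma derivation0 (R S : nzRingType) (g d : R -> S) : derivation g d -> d 0 = 0.
Proof. by case=> dD _; apply: (addrI (d 0)); rewrite -dD !addr0. Qed.

Lemma derivation_sum (R S : nzRingType) (g d : R -> S) :
  derivation g d -> forall I (s : seq I) (f : I -> R),
  d (\sum_(i <- s) f i) = \sum_(i <- s) d (f i).
Proof. by move=> dd I s f; apply: (big_morph d dd.1 (derivation0 dd)). Qed.

Lemma tder_derivation n k : derivation idfun (@tder n k).
Proof.
elim: n => [|n IHn] /=; first by split=> a b; rewrite ?mul0r ?mulr0 addr0.
case: eqP => [_|_]; first by split=> a b; rewrite ?derivD ?derivM.
have d0 := derivation0 IHn; have [dD dM] := IHn.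
split=> a b; apply/polyP => i.
  by rewrite !(coefD, coef_map_id0) // dD.
rewrite !(coefD, coef_map_id0) // !coefM (derivation_sum IHn) -big_split /=.
by apply: eq_bigr => j _; rewrite !coef_map_id0 // dM.
Qed.

Lemma tder_const n k c : tder k (tconst n c) = 0.
Proof.
elim: n => //= n IHn; case: eqP => _; first exact: derivC.
apply/polyP => i; rewrite coef_map_id0 ?(derivation0 (tder_derivation n k)) //.
by rewrite coefC coef0; case: eqP; rewrite ?(derivation0 (tder_derivation n k)).
Qed.

Lemma tder_polyC n k (a : tower n) :
  (k < n)%N -> @tder n.+1 k a%:P = (tder k a)%:P.
Proof.
move=> kn; rewrite /= ltn_eqF //; have d0 := derivation0 (tder_derivation n k).
by apply/polyP => i; rewrite coef_map_id0 // !coefC; case: eqP.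
Qed.

Lemma tder_var n k i : (i < n)%N -> (k < n)%N -> tder k (tvar n i) = (k == i)%:R.
Proof.
elim: n => // n IHn.
have d0 := derivation0 (tder_derivation n k); have [dD dM] := tder_derivation n k.
have d1 : tder k (1 : tower n) = 0 by rewrite -(rmorph1 (tconst n)) tder_const.
rewrite ltnS leq_eqVlt => /orP[/eqP->|in_];
  rewrite ltnS leq_eqVlt => /orP[/eqP->|kn] /=; rewrite ?eqxx.
- by rewrite derivX.
- rewrite ltn_eqF //; apply/polyP => j.
  by rewrite coef_map_id0 // coefX coef0; case: eqP.
- by rewrite (ltn_eqF in_) derivC gtn_eqF.
rewrite (ltn_eqF in_) (ltn_eqF kn) -polyC_natr -IHn //.
by have := tder_polyC (tvar n i) kn; rewrite /= (ltn_eqF kn).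
Qed.

Lemma tower_derivation_uniq n (S : nzRingType) (g : {rmorphism tower n -> S})
    (d d' : tower n -> S) : derivation g d -> derivation g d' ->
  (forall c, d (tconst n c) = d' (tconst n c)) ->
  (forall i, (i < n)%N -> d (tvar n i) = d' (tvar n i)) -> d =1 d'.
Proof.
elim: n S g d d' => // n IHn S g d d' dd dd' dc dv.
have dX : d 'X = d' 'X by have := dv n (ltnSn n); rewrite /= eqxx.
have dC (a : tower n) : d a%:P = d' a%:P.
  apply: (IHn S (g \o polyC) (d \o polyC) (d' \o polyC)) => [||c|i ni].
  - by case: dd => dD dM; split=> x y /=; rewrite ?polyCD ?polyCM ?dD ?dM.
  - by case: dd' => dD dM; split=> x y /=; rewrite ?polyCD ?polyCM ?dD ?dM.
  - exact: dc.
  by have := dv i (leqW ni); rewrite /= ltn_eqF.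
elim/poly_ind => [|p c IHp].
  by rewrite (derivation0 dd) (derivation0 dd').
by case: dd dd' => dD dM [dD' dM']; rewrite dD dD' dM dM' IHp dX dC.
Qed.

End Tower.

Arguments tconst {F}.
Arguments tvar F n i : clear implicits.
Arguments tder {F n}.

(** * Nonzero constants, nonroots and units in characteristic zero *)

Section TowerChar0.
Variable F : numClosedFieldType.

Lemma tower_char0 n : [pchar tower F n] =i pred0.
Proof.
by move=> p; rewrite (fmorph_pchar (tconst n)) pchar_num.
Qed.

(** Repeated differentiation lowers a nonzero polynomial to a nonzero constant, one variable at a
    time. *)
Lemma tower_derivative_closed n (Q : tower F n -> Prop) f : Q f -> f != 0 ->
  (forall k g, (k < n)%N -> Q g -> Q (tder k g)) ->
  exists2 c, c != 0 & Q (tconst n c).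
Proof.
elim: n Q f => [|n IHn] Q f Qf f0 Qd; first by exists f.
move: {2}(size f) (leqnn (size f)) => s; elim: s f f0 Qf => [|s IHs] f f0 Qf sf.
  by move: sf; rewrite leqn0 size_poly_eq0 (negPf f0).
have [d0|dn0] := eqVneq f^`() 0; last first.
  apply: (IHs f^`()) => //.
    by have := Qd n f (ltnSn n) Qf; rewrite /= eqxx.
  by rewrite -ltnS (leq_trans _ sf) // lt_size_deriv.
have fE := deriv_eq0 (@tower_char0 n) d0.
have [|||c c0 Qc] := IHn (fun a => Q a%:P) f`_0.
- by rewrite -fE.
- by apply: contraNneq f0 => z; rewrite fE z.
- by move=> k g kn Qg; rewrite -tder_polyC //; apply: Qd => //; apply: leqW.
by exists c.
Qed.

Lemma tower_nonroot n (f : tower F n) :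
  f != 0 -> exists z, tmor idfun z n f != 0.
Proof.
elim: n f => [|n IHn] f f0; first by exists (fun=> 0).
have [z zl] : exists z, tmor idfun z n (lead_coef f) != 0.
  by apply: IHn; rewrite lead_coef_eq0.
have [|c cf] := @exists_nonroot F (map_poly (tmor idfun z n) f).
  by rewrite -size_poly_gt0 size_map_poly_id0 // size_poly_gt0.
exists (fun i => if i == n then c else z i); rewrite tmorS eqxx.
rewrite (@eq_map_poly _ _ _ (tmor idfun z n)) //; apply: tmor_ext => i ni.
by rewrite ltn_eqF.
Qed.

(** A one-polynomial Nullstellensatz: at a point where the leading coefficient does not vanish, a
    polynomial of positive degree in the last variable keeps that degree and acquires a root. *)
Lemma tower_no_root n (f : tower F n) :
  (forall z, tmor idfun z n f != 0) -> f \is a GRing.unit.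
Proof.
elim: n f => [|n IHn] f fz; first by rewrite unitfE; apply: (fz (fun=> 0)).
have f0 : f != 0.
  by apply: contraNneq (fz (fun=> 0)) => ->; rewrite rmorph0.
have set_last z c p : tmor idfun (fun i => if i == n then c else z i) n.+1 p
    = (map_poly (tmor idfun z n) p).[c].
  rewrite tmorS eqxx (@eq_map_poly _ _ _ (tmor idfun z n)) //.
  by apply: tmor_ext => i ni; rewrite ltn_eqF.
have sf : size f = 1.
  apply/eqP; rewrite eqn_leq size_poly_gt0 f0 andbT leqNgt; apply/negP => sf.
  have [|z zl] := @tower_nonroot n (lead_coef f); first by rewrite lead_coef_eq0.
  have /closed_rootP[c cf] : size (map_poly (tmor idfun z n) f) != 1.
    by rewrite size_map_poly_id0 // gtn_eqF.
  by have := fz (fun i => if i == n then c else z i); rewrite set_last (eqP cf) eqxx.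
rewrite poly_unitE sf eqxx /=; apply: IHn => z.
have := fz (fun i => if i == n then 0 else z i); rewrite set_last.
by rewrite [X in map_poly _ X]size1_polyC ?sf // map_polyC hornerC.
Qed.

End TowerChar0.

(** * Cancelling denominators *)

Section PrimeContraction.
Variables (R B : idomainType) (theta : {rmorphism {poly R} -> B}) (D : B -> B).
Hypotheses (fR : factorial_ring R) (fB : factorial_ring B).
Hypothesis natB_unit : forall e, e.+1%:R \is a @GRing.unit B.
Hypothesis D_der : derivation idfun D.
Hypothesis D_theta : forall f, D (theta f) = theta f^`().
Hypothesis theta_inj : injective theta.
Variable p : B.
Hypotheses (p_prime : prime_elt p) (p_Dp : ~ dvdr p (D p)).

Lemma derivation_exp a e : D (a ^+ e.+1) = e.+1%:R * (a ^+ e * D a).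
Proof.
have [_ DM] := D_der.
elim: e => [|e IHe]; first by rewrite expr1 expr0 !mul1r.
by rewrite exprS DM /= IHe [in RHS]mulrS exprS; ring.
Qed.

(** If [b = h * p ^+ e] with [e] positive, then [D b = 0] forces [p] to divide [e * h * D p], hence
    [h]. So all powers of [p] divide [b]. *)
Lemma prime_dvd_derivation_const b : D b = 0 -> dvdr p b -> b = 0.
Proof.
move=> Db0 pb; have [p0 _ pP] := p_prime; have [DD DM] := D_der.
have pe e : dvdr (p ^+ e) b.
  elim: e => [|[|e] IHe]; first by exists b; rewrite expr0 mulr1.
    by rewrite expr1.
  case: IHe => h bE; have : dvdr p (e.+1%:R * (h * D p)).
    exists (- D h); apply: (mulfI (expf_neq0 e p0)).
    move: Db0; rewrite bE DM derivation_exp /= => /eqP.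
    rewrite addrC addr_eq0 exprSr => /eqP E.
    transitivity (h * (e.+1%:R * (p ^+ e * D p))); first by ring.
    by rewrite E; ring.
  case/pP => [/(prime_not_dvd_unit p_prime (natB_unit e)) //|].
  case/pP => // -[h' hE]; exists h'.
  by rewrite bE hE [in RHS]exprS mulrA.
apply/eqP; case: eqVneq => // b0; have [s sb] := fB b0.
by have := prime_prod_exp_bound p_prime sb (pe (size s).+1); rewrite ltnn.
Qed.

(* The contraction of the prime [p] is principal: it meets the constants [R]
   trivially, so a prime factor of least degree in it generates it. *)
Lemma prime_contraction_principal f : f != 0 -> dvdr p (theta f) ->
  exists2 q, dvdr p (theta q) & forall g, dvdr p (theta g) -> dvdr q g.
Proof.
move=> f0 pf; have [_ _ pP] := p_prime.
have const0 (c : R) : dvdr p (theta c%:P) -> c = 0.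
  move=> /(prime_dvd_derivation_const _) c0; apply/eqP; rewrite -polyC_eq0.
  by apply/eqP/theta_inj; rewrite rmorph0 c0 // D_theta derivC rmorph0.
have [g [g0 pg gmin]] : exists g, [/\ g != 0, dvdr p (theta g) &
    forall h, dvdr p (theta h) -> (size h < size g)%N -> h = 0].
  move: {2}(size f).+1 (ltnSn (size f)) => n.
  elim: n f f0 pf => // n IHn f f0 pf fn.
  case: (classic (exists h, [/\ h != 0, dvdr p (theta h) & (size h < size f)%N])).
    by case=> h [h0 ph hf]; apply: (IHn h) => //; apply: leq_trans hf _.
  move=> N; exists f; split=> // h ph hf; apply/eqP.
  by case: eqVneq => // h0; case: N; exists h.
have [s [sp [u uu gE]]] := factorial_poly fR g0.
have [q qs pq] : exists2 q, q \in s & dvdr p (theta q).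
  move: pg; rewrite gE rmorphM => /pP[|].
    by move/(prime_not_dvd_unit p_prime (rmorph_unit _ uu)).
  rewrite rmorph_prod -(big_map theta xpredT id).
  by move=> /(prime_dvd_prod p_prime)[_ /mapP[q qs ->]]; exists q.
have [q0 _ qP] := sp q qs.
have qg : (size q <= size g)%N.
  rewrite gE (perm_big _ (perm_to_rem qs)) big_cons /= mulrCA size_mul //.
    rewrite -subn1 -addnBA ?leq_addr // size_poly_gt0.
    by apply: contraNneq g0 => z; rewrite gE (perm_big _ (perm_to_rem qs))
      big_cons /= mulrCA z mulr0.
  by apply: contraNneq g0 => z; rewrite gE (perm_big _ (perm_to_rem qs))
      big_cons /= mulrCA z mulr0.
have sq : (1 < size q)%N.
  rewrite ltnNge; apply/negP => /size1_polyC qE; rewrite qE in pq.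
  by move: q0; rewrite qE (const0 _ pq) eqxx.
exists q => // h ph.
have E := Pdiv.Idomain.divp_eq h q.
have r0 : h %% q = 0.
  apply: gmin; last by apply: leq_trans qg; rewrite ltn_modp.
  have -> : h %% q = (lead_coef q ^+ scalp h q)%:P * h - h %/ q * q.
    by rewrite mul_polyC E addrC addKr.
  rewrite rmorphB !rmorphM; apply: dvdrB; exact: dvdr_mull.
have : dvdr q ((lead_coef q ^+ scalp h q)%:P * h).
  by rewrite mul_polyC E r0 addr0; apply/dvdr_mull/dvdrr.
(* The prime [q] divides [h] or the constant; the latter is excluded, [q] having positive degree. *)
case/qP=> // -[k kE]; exfalso.
have c0 : lead_coef q ^+ scalp h q != 0 by rewrite expf_neq0 ?lead_coef_eq0.
have k0 : k != 0.
  by apply: contraNneq c0 => z; rewrite -polyC_eq0 kE z mul0r.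
have := size_polyC (lead_coef q ^+ scalp h q); rewrite c0 kE size_mul //=.
move: sq; rewrite -size_poly_gt0 in k0.
by case: (size k) k0 => // a _; case: (size q) => [|[|b]] // _; rewrite !addnS.
Qed.

End PrimeContraction.

(** * Derivations dual to the components of a polynomial map *)

Section Keller.
Variables (F : numClosedFieldType) (N : nat).
Local Notation B := (tower F N).
Variables (P : nat -> B) (D : nat -> B -> B).
Hypothesis D_der : forall k, derivation idfun (D k).
Hypothesis D_const : forall k c, D k (tconst N c) = 0.
Hypothesis D_P : forall k j, (k < N)%N -> (j < N)%N -> D k (P j) = (k == j)%:R.

Local Notation sub P := (tmor (tconst N) P N).

(** Both sides are derivations along [sub P] that agree on constants and variables. *)
Lemma derivation_tmor k f : (k < N)%N -> D k (sub P f) = sub P (tder k f).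
Proof.
move=> kN; move: f; apply: (tower_derivation_uniq (g := sub P)).
- have [DD DM] := D_der k.
  by split=> a b /=; rewrite ?rmorphD ?rmorphM ?DD ?DM.
- have [DD DM] := tder_derivation F N k.
  by split=> a b /=; rewrite ?DD ?DM ?rmorphD ?rmorphM.
- by move=> c; rewrite tmor_const D_const tder_const rmorph0.
by move=> i iN; rewrite tmor_var // D_P // tder_var // rmorph_nat.
Qed.

(** The kernel is stable under every [tder k] with [k < N], so a nonzero element of it would lead to
    a nonzero constant in it. *)
Lemma tmor_inj : injective (sub P).
Proof.
apply: raddf_inj => f f0; apply/eqP; case: eqVneq => // fn0.
have [|c c0] := tower_derivative_closed (Q := fun f => sub P f = 0) f0 fn0.
  by move=> k g kN g0; rewrite -derivation_tmor // g0 (derivation0 (D_der k)).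
by rewrite tmor_const => /eqP; rewrite fmorph_eq0 (negPf c0).
Qed.

End Keller.

Lemma nat_tower_unit (F : numClosedFieldType) N e :
  e.+1%:R \is a @GRing.unit (tower F N).
Proof. by rewrite -(rmorph_nat (tconst N)) tconst_unit // pnatr_eq0. Qed.

(** The transposition of [n] and [k], used to turn variable [k] into the outermost one of the
    tower. *)
Definition swap_last (n k j : nat) : nat := if j == k then n else if j == n then k else j.

Lemma swap_lastK n k : involutive (swap_last n k).
Proof.
move=> j; rewrite /swap_last; case: (eqVneq j k) => [->|jk].
  by rewrite eqxx; case: eqVneq.
case: (eqVneq j n) => [->|jn]; first by rewrite eqxx.
by rewrite (negPf jk) (negPf jn).
Qed.

Lemma ltn_swap_last n k j : (k < n.+1)%N -> (j < n.+1)%N -> (swap_last n k j < n.+1)%N.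
Proof. by rewrite /swap_last; do 2?case: eqP. Qed.

(** * Contracted primes and cancellation of denominators *)

Section KellerDescent.
Variables (F : numClosedFieldType) (N : nat).
Local Notation B := (tower F N).
Variables (P : nat -> B) (D : nat -> B -> B).
Hypothesis D_der : forall k, derivation idfun (D k).
Hypothesis D_const : forall k c, D k (tconst N c) = 0.
Hypothesis D_P : forall k j, (k < N)%N -> (j < N)%N -> D k (P j) = (k == j)%:R.

Local Notation sub P := (tmor (tconst N) P N).

Lemma keller_contraction_principal (p : B) f :
  prime_elt p -> f != 0 -> dvdr p (sub P f) ->
  exists2 q, dvdr p (sub P q) & forall g, dvdr p (sub P g) -> dvdr q g.
Proof.
move=> pp f0 pf.
(* Otherwise the contraction of [p] would be stable under every partial derivative and contain a
   nonzero constant. *)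
have [k [h [kN ph Nph]]] : exists k h,
    [/\ (k < N)%N, dvdr p (sub P h) & ~ dvdr p (sub P (tder k h))].
  apply: NNPP => H.
  have [|c c0] := tower_derivative_closed (Q := fun f => dvdr p (sub P f)) pf f0.
    move=> k g kN pg; apply: NNPP => npg; apply: H; by exists k, g.
  by rewrite tmor_const => /(prime_not_dvd_unit pp (tconst_unit N c0)).
have pDp : ~ dvdr p (D k p).
  move=> pDp; apply: Nph; rewrite -(derivation_tmor D_der D_const D_P) //.
  have [_ DM] := D_der k; case: ph => a ->; rewrite DM /=.
  by apply: dvdrD; apply: dvdr_mull => //; apply: dvdrr.
move: D_der D_const D_P f f0 pf kN pp pDp {h ph Nph}; move: p P D.
case: N => // n p P' D' der cst DP f f0 pf kN pp pDp.
(* Variables are renamed so that variable [k] becomes outermost; [tower n.+1] is then a polynomial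
   ring in it, and the univariate statement applies. *)
pose t := swap_last n k; pose P1 j := P' (t j); pose D1 j := D' (t j).
have tn : t n = k by rewrite /t /swap_last; case: (eqVneq n k) => [->|]; rewrite ?eqxx.
have D1P i j : (i < n.+1)%N -> (j < n.+1)%N -> D1 i (P1 j) = (i == j)%:R.
  move=> ni nj; rewrite /D1 /P1 DP ?ltn_swap_last //.
  by rewrite (inj_eq (can_inj (@swap_lastK n k))).
have D1der i : derivation idfun (D1 i) by apply: der.
have D1c i c : D1 i (tconst n.+1 c) = 0 by apply: cst.
pose rho := tmor (tconst n.+1) (fun j => tvar F n.+1 (t j)) n.+1.
have P1rho g : tmor (tconst n.+1) P1 n.+1 (rho g) = tmor (tconst n.+1) P' n.+1 g.
  rewrite tmor_comp; apply: tmor_ext => i ni.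
  by rewrite tmor_var ?ltn_swap_last // /P1 /t swap_lastK.
have Prho g : tmor (tconst n.+1) P' n.+1 (rho g) = tmor (tconst n.+1) P1 n.+1 g.
  by rewrite tmor_comp; apply: tmor_ext => i ni; rewrite tmor_var ?ltn_swap_last.
have inj1 := tmor_inj D1der D1c D1P.
have injP := tmor_inj der cst DP.
have rhoK g : rho (rho g) = g by apply: injP; rewrite Prho P1rho.
have rho0 : rho f != 0.
  by apply: contraNneq f0 => z; rewrite -(rhoK f) z rmorph0.
have [|||q pq qP] := @prime_contraction_principal (tower F n) (tower F n.+1)
  (tmor (tconst n.+1) P1 n.+1) (D1 n) (@factorial_tower F n)
  (@factorial_tower F n.+1) (@nat_tower_unit F n.+1) (D1der n) _ inj1 p pp _
  (rho f) rho0.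
- move=> g; rewrite (derivation_tmor D1der D1c D1P) //=.
  by rewrite eqxx.
- by rewrite /D1 tn.
- by rewrite P1rho.
exists (rho q); first by rewrite Prho.
move=> g; rewrite -P1rho => /qP [h gE].
by exists (rho h); rewrite -(rhoK g) gE rmorphM.
Qed.

(* Each prime factor of a denominator [sub P d] comes from a common factor of
   [d] and [a], so that denominators cancel completely. *)
Lemma keller_birational (x : B) a d :
  d != 0 -> sub P d * x = sub P a -> exists a', x = sub P a'.
Proof.
have inj := tmor_inj D_der D_const D_P.
(* The induction runs on the number of prime factors of a multiple [b] of the denominator: dividing
   [d] by [q] allows one prime to be removed from [b]. *)
move=> d0; have [b [db [s sb]]] :
    exists b, dvdr (sub P d) b /\ exists s, prime_prod s b.
  exists (sub P d); split; first exact: dvdrr.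
  by apply: factorial_tower; rewrite raddf_eq0.
move: {2}(size s).+1 (ltnSn (size s)) => n.
elim: n s b a d d0 db sb => // n IHn s b a d d0 db sb sn E.
case: (boolP (sub P d \is a GRing.unit)) => [/tower_unitP[c c0 dE]|du].
  exists (tconst N c^-1 * a); rewrite rmorphM tmor_const -E dE mulrA -rmorphM.
  by rewrite mulVf // rmorph1 mul1r.
have sd0 : sub P d != 0 by rewrite raddf_eq0.
have [p pp pd] := prime_divisor (@factorial_tower F N) sd0 du.
have [q pq qP] := keller_contraction_principal pp d0 pd.
have [d' dE] := qP _ pd.
have [|a' aE] := qP a; first by rewrite -E; apply: dvdr_mulr.
have q0 : q != 0 by apply: contraNneq d0 => z; rewrite dE z mulr0.
have d'0 : d' != 0 by apply: contraNneq d0 => z; rewrite dE z mul0r.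
have sq0 : sub P q != 0 by rewrite raddf_eq0.
have [b' [s' [bE sb' ss']]] := prime_prod_divide pp sb (dvdr_trans pd db).
have [p0 _ _] := pp.
apply: (IHn s' b' a' d') => //; last 1 first.
- by apply: (mulIf sq0); rewrite -rmorphM -aE -E dE rmorphM mulrAC.
- case: pq db => c cE [e eE]; exists (e * c); apply: (mulfI p0).
  by rewrite -bE eE dE rmorphM cE; ring.
by rewrite -ltnS -ss'.
Qed.

End KellerDescent.

(** * The polynomial inverse *)

Section CpolyEvaluation.
Variables (F : numClosedFieldType) (N : nat).
Implicit Types (p : cpoly F N) (P Q : 'I_N -> cpoly F N).

Fixpoint cev (S : nzRingType) (f : F -> S) (z : 'I_N -> S) p : S :=
  match p with
  | PVar i => z i
  | PConst c => f c
  | PAdd p q => cev f z p + cev f z q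
  | PMul p q => cev f z p * cev f z q
  end.

Lemma rmorph_cev (S T : nzRingType) (h : {rmorphism S -> T}) f z f' z' p :
  (forall c, h (f c) = f' c) -> (forall i, h (z i) = z' i) ->
  h (cev f z p) = cev f' z' p.
Proof.
move=> hf hz; elim: p => //= p IHp q IHq.
  by rewrite rmorphD IHp IHq.
by rewrite rmorphM IHp IHq.
Qed.

(** Families over ['I_N] become families over [nat], as [tmor] expects, with default 0 from [N]
    on. *)
Definition nat_ext (S : nmodType) (z : 'I_N -> S) (i : nat) : S :=
  if insub i is Some k then z k else 0.

Lemma nat_extE (S : nmodType) (z : 'I_N -> S) (k : 'I_N) : nat_ext z k = z k.
Proof. by rewrite /nat_ext valK. Qed.

Lemma nat_ext_lt (S : nmodType) (z : 'I_N -> S) i (iN : (i < N)%N) :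
  nat_ext z i = z (Ordinal iN).
Proof. exact: (nat_extE z (Ordinal iN)). Qed.

Definition poly_of p : tower F N := cev (tconst N) (fun i => tvar F N i) p.

Lemma poly_ofE :
  ((forall i, poly_of (PVar i) = tvar F N i)
  * (forall c, poly_of (PConst c) = tconst N c)
  * (forall p q, poly_of (PAdd p q) = (poly_of p + poly_of q)%R)
  * (forall p q, poly_of (PMul p q) = (poly_of p * poly_of q)%R))%type.
Proof. by []. Qed.

(** The substitution written theta in the overview. *)
Definition comp_hom P : {rmorphism tower F N -> tower F N} :=
  tmor (tconst N) (nat_ext (fun j => poly_of (P j))) N.

Lemma comp_hom_var P (j : 'I_N) : comp_hom P (tvar F N j) = poly_of (P j).
Proof. by rewrite /comp_hom tmor_var // nat_extE. Qed.

Fixpoint csubst p Q : cpoly F N :=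
  match p with
  | PVar i => Q i
  | PConst c => PConst c
  | PAdd p q => PAdd (csubst p Q) (csubst q Q)
  | PMul p q => PMul (csubst p Q) (csubst q Q)
  end.

Lemma poly_of_csubst p Q : poly_of (csubst p Q) = comp_hom Q (poly_of p).
Proof.
elim: p => [i|c|p IHp q IHq|p IHp q IHq] /=; rewrite !poly_ofE.
- by rewrite comp_hom_var.
- by rewrite /comp_hom tmor_const.
- by rewrite IHp IHq -rmorphD.
by rewrite IHp IHq -rmorphM.
Qed.

Lemma ceval_csubst n p Q (X : 'I_N -> 'M[F]_n) :
  ceval (csubst p Q) X = ceval p (polymap Q X).
Proof. by elim: p => //= p -> q ->. Qed.

Lemma poly_of_surj (f : tower F N) : exists p, poly_of p = f.
Proof.
suff H n g : (n <= N)%N ->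
    exists p, poly_of p = tmor (tconst N) (tvar F N) n g.
  have [p pE] := H N f (leqnn N); exists p; rewrite pE {p pE}.
  move: f; apply: (tower_hom_uniq (h := idfun)) => [c|i iN] /=.
    by rewrite tmor_const.
  by rewrite tmor_var.
elim: n g => [|n IHn] g nN; first by exists (PConst g).
elim/poly_ind: g => [|g c [p pE]].
  by exists (PConst 0); rewrite poly_ofE !rmorph0.
have [q qE] := IHn c (ltnW nN).
exists (PAdd (PMul p (PVar (Ordinal nN))) q).
rewrite rmorphD rmorphM -pE !poly_ofE qE /=.
by rewrite horner_morphX horner_morphC.
Qed.

(** The variables are adjoined one at a time; the invariant that every [X i] commutes with the image
    of [psi] is what makes the next evaluation a ring morphism. The size is [n.+1] because matrices
    of size 0 form the zero ring. *)
Lemma tower_matrix_hom n (X : 'I_N -> 'M[F]_n.+1) : commuting X ->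
  exists psi : {rmorphism tower F N -> 'M[F]_n.+1},
    forall p, ceval p X = psi (poly_of p).
Proof.
move=> cX.
have H m : (m <= N)%N -> exists psi : {rmorphism tower F m -> 'M[F]_n.+1},
    [/\ forall c, psi (tconst m c) = c%:M,
        forall i : 'I_N, (i < m)%N -> psi (tvar F m i) = X i
      & forall (i : 'I_N) f, GRing.comm (X i) (psi f)].
  elim: m => [|m IHm] mN.
    exists (@scalar_mx F n.+1); split=> // i f.
    by rewrite /GRing.comm /= -!mulmxE scalar_mxC.
  have [psi [psic psiv psiC]] := IHm (ltnW mN).
  pose psi1 := horner_morph (psiC (Ordinal mN)) :
    {rmorphism {poly tower F m} -> 'M[F]_n.+1}.
  exists psi1; split=> [c|i|i f].
  - by rewrite /= horner_morphC.
  - rewrite ltnS leq_eqVlt /=; case: eqP => [im _|_ im].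
      by rewrite horner_morphX; congr (X _); apply: val_inj.
    by rewrite horner_morphC psiv.
  elim/poly_ind: f => [|f c IHf]; first by rewrite rmorph0; apply: commr0.
  rewrite rmorphD rmorphM /=; apply: commrD; last by rewrite horner_morphC.
  by apply: commrM => //; rewrite horner_morphX /GRing.comm -!mulmxE cX.
have [psi [psic psiv _]] := H N (leqnn N).
exists psi; elim=> [i|c|p IHp q IHq|p IHp q IHq] /=; rewrite poly_ofE.
- by rewrite psiv.
- by rewrite psic.
- by rewrite IHp IHq -rmorphD.
by rewrite IHp IHq rmorphM.
Qed.

Lemma ceval_poly_of n (X : 'I_N -> 'M[F]_n) p q : commuting X ->
  poly_of p = poly_of q -> ceval p X = ceval q X.
Proof.
case: n X => [|n] X cX pq; first by rewrite [LHS]flatmx0 [RHS]flatmx0.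
by have [psi psiE] := tower_matrix_hom cX; rewrite !psiE pq.
Qed.

Lemma commuting_ceval n (X : 'I_N -> 'M[F]_n) p q : commuting X ->
  ceval p X *m ceval q X = ceval q X *m ceval p X.
Proof.
move=> cX; apply: (@ceval_poly_of n X (PMul p q) (PMul q p)) => //.
exact: mulrC.
Qed.

(** A point [z] with a tangent vector [v], over the dual numbers realized as 2 x 2 matrices with
    [delta_mx 0 1] as infinitesimal. *)
Definition dual_tuple (z : nat -> F) (v : 'I_N -> F) : 'I_N -> 'M[F]_2 :=
  fun i => (z i)%:M + v i *: delta_mx 0 1.

Lemma commuting_dual_tuple z v : commuting (dual_tuple z v).
Proof.
move=> i j; have scC c (A : 'M[F]_2) : GRing.comm c%:M A by rewrite /GRing.comm -!mulmxE scalar_mxC.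
rewrite !mulmxE; apply: commrD; first exact/commr_sym/scC.
apply: commr_sym; apply: commrD; first exact/commr_sym/scC.
by rewrite /GRing.comm -!scalerAl -!scalerAr !scalerA mulrC.
Qed.

Lemma ceval_dual_tuple z v p :
  ceval p (dual_tuple z v) = (tmor idfun z N (poly_of p))%:M
    + (\sum_(i < N) v i * tmor idfun z N (tder i (poly_of p))) *: delta_mx 0 1.
Proof.
have EE : (delta_mx 0 1 : 'M[F]_2) *m (delta_mx 0 1 : 'M[F]_2) = 0 by rewrite mul_delta_mx_0.
elim: p => [i|c|p IHp q IHq|p IHp q IHq] /=; rewrite poly_ofE.
- rewrite tmor_var // /dual_tuple (bigD1 i) //= tder_var // eqxx.
  rewrite rmorph1 mulr1 big1 ?addr0 // => j ji.
  by rewrite tder_var // (negPf (ji : val j != val i)) rmorph0 mulr0.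
- rewrite tmor_const big1 ?scale0r ?addr0 // => i _.
  by rewrite tder_const rmorph0 mulr0.
- rewrite IHp IHq rmorphD raddfD /= addrACA -scalerDl.
  congr (_ + _ *: _); rewrite -big_split /=; apply: eq_bigr => i _.
  by have [dD _] := tder_derivation F N i; rewrite dD rmorphD mulrDr.
rewrite IHp IHq rmorphM.
set a := tmor _ _ _ (poly_of p); set b := tmor _ _ _ (poly_of q).
rewrite mulmxDl !mulmxDr -!scalemxAl -!scalemxAr EE !scaler0 addr0.
rewrite -scalar_mxM !mul_scalar_mx !mul_mx_scalar !scalerA -addrA -scalerDl.
congr (_ + _ *: _); rewrite !mulr_suml -big_split /=.
apply: eq_bigr => i _; have [_ dM] := tder_derivation F N i.
by rewrite dM rmorphD !rmorphM /= -/a -/b; ring.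
Qed.

End CpolyEvaluation.

(** * Inverting an injective polynomial map *)

Section Inverse.
Variables (F : numClosedFieldType) (N : nat) (P : 'I_N -> cpoly F N).
Local Notation B := (tower F N).
Hypothesis P_inj : forall (n : nat) (X Y : 'I_N -> 'M[F]_n),
  commuting X -> commuting Y ->
  (forall j, polymap P X j = polymap P Y j) -> forall i, X i = Y i.

Lemma injective_points (a b : nat -> F) :
  (forall j : 'I_N, tmor idfun a N (poly_of (P j)) = tmor idfun b N (poly_of (P j))) ->
  forall i : 'I_N, a i = b i.
Proof.
move=> ab i; have := P_inj (commuting_dual_tuple a (fun=> 0))
  (commuting_dual_tuple b (fun=> 0)) _ i.
have s0 (c : nat -> F) (j : 'I_N) : \sum_(i < N) 0 * tmor idfun c N (tder i (poly_of (P j))) = 0.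
  by rewrite big1 // => k _; rewrite mul0r.
have H j : polymap P (dual_tuple a (fun=> 0)) j = polymap P (dual_tuple b (fun=> 0)) j.
  by rewrite /polymap !ceval_dual_tuple !s0 ab.
by move/(_ H)/matrixP/(_ 0 0); rewrite /dual_tuple !scale0r !addr0 !mxE.
Qed.

Definition jacobian : 'M[B]_N := \matrix_(i, j) tder i (poly_of (P j)).

(** A kernel vector of the Jacobian at [z] would be a tangent vector that [P] cannot tell from zero,
    against injectivity. So the determinant has no zero and is a unit. *)
Lemma jacobian_unit : jacobian \in unitmx.
Proof.
rewrite unitmxE; apply: tower_no_root => z; rewrite -det_map_mx.
apply/det0P => -[v v0 vJ]; case/eqP: v0; apply/rowP => i; rewrite mxE.
have H j : polymap P (dual_tuple z (fun i => v 0 i)) j = polymap P (dual_tuple z (fun=> 0)) j.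
  rewrite /polymap !ceval_dual_tuple; congr (_ + _ *: _).
  rewrite [RHS]big1; last by move=> k _; rewrite mul0r.
  have /rowP/(_ j) := vJ; rewrite !mxE => E; rewrite -[RHS]E.
  by apply: eq_bigr => k _; rewrite !mxE.
have /matrixP/(_ 0 1) := P_inj (commuting_dual_tuple _ _) (commuting_dual_tuple _ _) H i.
by rewrite /dual_tuple scale0r addr0 !mxE /= add0r mulr1.
Qed.

(** The derivation dual to [P_k]: the partial derivatives combined by row [k] of the inverse
    Jacobian. *)
Definition jder (k : nat) (b : B) : B :=
  \sum_(i < N) nat_ext (fun k => invmx jacobian k i) k * tder i b.

Lemma jder_derivation k : derivation idfun (jder k).
Proof.
split=> a b; rewrite /jder.
  rewrite -big_split; apply: eq_bigr => i _ /=.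
  by have [dD _] := tder_derivation F N i; rewrite dD mulrDr.
rewrite mulr_suml mulr_sumr -big_split; apply: eq_bigr => i _ /=.
by have [_ dM] := tder_derivation F N i; rewrite dM /=; ring.
Qed.

Lemma jder_const k c : jder k (tconst N c) = 0.
Proof. by rewrite /jder big1 // => i _; rewrite tder_const mulr0. Qed.

Lemma jder_P k j : (k < N)%N -> (j < N)%N ->
  jder k (nat_ext (fun j => poly_of (P j)) j) = (k == j)%:R.
Proof.
move=> kN jN; have := mulVmx jacobian_unit.
move/matrixP/(_ (Ordinal kN) (Ordinal jN)); rewrite !mxE => E.
rewrite -[(k == j)%:R]E; apply: eq_bigr => i _.
by rewrite !nat_ext_lt mxE.
Qed.

Lemma comp_hom_inj : injective (comp_hom P).
Proof. exact: tmor_inj jder_derivation jder_const jder_P. Qed.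

(* If [x_i] were not in the fraction field of the image of [comp_hom P], a
   generic point would have two preimages under P with distinct [i]-th
   coordinates. *)
Lemma injective_birational (i : 'I_N) :
  exists a d, d != 0 /\ comp_hom P d * tvar F N i = comp_hom P a.
Proof.
apply: NNPP => nrat; pose L := {fraction B}.
(* The generic point of the target is [P(x)], with [x] the generic point of the source in [L]. *)
pose phi : {rmorphism B -> L} := @tofrac B \o comp_hom P.
have phi0 z : phi z = 0 -> z = 0.
  move=> /eqP; rewrite /= tofrac_eq0 => /eqP z0.
  by apply: comp_hom_inj; rewrite z0 rmorph0.
have charL : [pchar L] =i pred0.
  by move=> p; rewrite (fmorph_pchar (@tofrac B \o tconst N)) pchar_num.
pose x (k : 'I_N) : L := tofrac (tvar F N k).
pose phi1 : {rmorphism {poly B} -> L} := horner_morph (fun z => mulrC (x i) (phi z)).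
have [r1 r1n0 H1] := extend_specialization_seq F [seq x k | k <- enum 'I_N] phi1.
have [|r rn0 H] := extend_specialization_twice F charL r1n0.
  move=> a b b0; apply/negP => /eqP /= E; apply: nrat; exists a, b; split.
    by apply: contraNneq b0 => ->; rewrite rmorph0.
  by apply/eqP; rewrite -tofrac_eq rmorphM; apply/eqP.
have r0 : r != 0 by apply: contraNneq rn0 => ->; rewrite rmorph0.
(* [phi] is injective, so evaluation at any point is a specialization; [z] only has to avoid the
   zeros of [r]. *)
have [z zr] := tower_nonroot r0; pose chi := tmor idfun z N.
have sp : specializes phi chi by move=> y /phi0 ->; rewrite rmorph0.
have [c [c' [cc' cr1 c'r1 cP]]] := H chi sp zr.
(* A value [d] of [x_i] compatible with its relations over [phi] and avoiding [r1] extends to values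
   of all coordinates, which form a point of the fibre over [z]. *)
have fiber d : (map_poly chi r1).[d] != 0 ->
    (forall h, (map_poly phi h).[x i] = 0 -> (map_poly chi h).[d] = 0) ->
    exists2 b : nat -> F, b i = d
      & forall j : 'I_N, tmor idfun b N (poly_of (P j)) = z j.
  move=> dr dP; pose chi1 : {rmorphism {poly B} -> F} := horner_morph (fun y => mulrC d (chi y)).
  have [R' [phi' [chi' [j [sp' jphi jchi jes]]]]] := H1 chi1 dP dr.
  have [w wE] : exists w : 'I_N -> R', forall k, phi' (w k) = x k.
    apply: (@fin_all_exists _ (fun=> R' : Type) (fun k w => phi' w = x k)) => k.
    by apply: jes; rewrite map_f // mem_enum.
  have wd : chi' (w i) = d.
    apply/eqP; rewrite -subr_eq0; have <- : chi' (j 'X) = d.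
      by rewrite jchi /= horner_morphX.
    rewrite -rmorphB; apply/eqP/sp'; rewrite rmorphB wE jphi /=.
    by rewrite horner_morphX subrr.
  pose f := j \o (polyC \o tconst N).
  exists (nat_ext (fun k => chi' (w k))) => [|k]; first by rewrite nat_extE.
  have -> : z k = chi' (j (tvar F N k)%:P).
    by rewrite jchi /= horner_morphC /chi tmor_var.
  rewrite (rmorph_cev (f' := idfun) (z' := fun k => chi' (w k))).
  - rewrite -(rmorph_cev (h := chi') (f := f) (z := w)) //; last first.
      by move=> a; rewrite /f /= jchi /= horner_morphC /chi tmor_const.
    (* The identity [P_k(x) = phi(y_k)] holds in [L] and is therefore preserved by [chi']. *)
    apply/eqP; rewrite -subr_eq0 -rmorphB; apply/eqP/sp'.
    rewrite rmorphB jphi /= horner_morphC /= comp_hom_var.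
    rewrite (rmorph_cev (f' := @tofrac B \o tconst N) (z' := x)) => [|a|//].
      rewrite (rmorph_cev (f' := @tofrac B \o tconst N) (z' := x)) //.
      by rewrite subrr.
    by rewrite /f /= jphi /= horner_morphC /= /comp_hom tmor_const.
  - by move=> a; rewrite tmor_const.
  by move=> m; rewrite tmor_var // nat_extE.
have [b bi bP] := fiber c cr1 (fun h h0 => (cP h h0).1).
have [b' b'i b'P] := fiber c' c'r1 (fun h h0 => (cP h h0).2).
case/eqP: cc'; rewrite -bi -b'i; apply: injective_points => j.
by rewrite bP b'P.
Qed.

Lemma polynomial_inverse : exists Q : 'I_N -> cpoly F N,
  forall (n : nat) (X : 'I_N -> 'M[F]_n), commuting X ->
    (forall i, polymap Q (polymap P X) i = X i) /\
    (forall i, polymap P (polymap Q X) i = X i).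
Proof.
have xE (i : 'I_N) : exists q, comp_hom P (poly_of q) = tvar F N i.
  have [a [d [d0 E]]] := injective_birational i.
  have [a' ->] := keller_birational jder_derivation jder_const jder_P d0 E.
  by have [q <-] := poly_of_surj a'; exists q.
have [Q QE] := fin_all_exists xE.
exists Q => n X cX; split=> i; rewrite /polymap -ceval_csubst.
  by apply: (ceval_poly_of (q := PVar i)) => //; rewrite poly_of_csubst QE.
(* A one-sided inverse is two-sided: the other composite is checked after applying the injective
   [comp_hom P]. *)
apply: (ceval_poly_of (q := PVar i)) => //; apply: comp_hom_inj.
have QP g : comp_hom P (comp_hom Q g) = g.
  rewrite /comp_hom tmor_comp.
  move: g; apply: (tower_hom_uniq (h := idfun)) => [c|k kN]; rewrite ?tmor_const //.
  by rewrite tmor_var // nat_ext_lt -/(comp_hom P) QE.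
by rewrite poly_of_csubst QP comp_hom_var.
Qed.

End Inverse.

(** * Block matrices *)

Section Blocks.
Variables (F : numClosedFieldType) (N n : nat).
Implicit Types (p : cpoly F N) (X Y H : 'I_N -> 'M[F]_n).

Lemma ceval_blockT X H p :
  ceval p (blockT X H) =
    block_mx (ceval p X) (ursubmx (ceval p (blockT X H))) 0 (ceval p X).
Proof.
suff [U ->] : exists U, ceval p (blockT X H) = block_mx (ceval p X) U 0 (ceval p X).
  by rewrite block_mxKur.
elim: p => [i|c|p [U pE] q [V qE]|p [U pE] q [V qE]] /=; rewrite ?pE ?qE.
- by exists (H i).
- by exists 0; rewrite -scalar_mx_block.
- by exists (U + V); rewrite add_block_mx addr0.
exists (ceval p X *m V + U *m ceval q X); rewrite mulmx_block.
by rewrite !mul0mx !mulmx0 !addr0 add0r.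
Qed.

Lemma ceval_blockT0 X p :
  ceval p (blockT X (fun=> 0)) = block_mx (ceval p X) 0 0 (ceval p X).
Proof.
elim: p => [i|c|p pE q qE|p pE q qE] //=; rewrite ?pE ?qE.
- by rewrite -scalar_mx_block.
- by rewrite add_block_mx !addr0.
by rewrite mulmx_block !mul0mx !mulmx0 !addr0 add0r.
Qed.

Lemma commuting_blockT X H : commuting X ->
  (forall i j, X i *m H j + H i *m X j = X j *m H i + H j *m X i) ->
  commuting (blockT X H).
Proof.
move=> cX XH i j; rewrite /blockT !mulmx_block.
by rewrite !mul0mx !mulmx0 !addr0 !add0r cX XH.
Qed.

End Blocks.

(** * Direct sums and commutator directions *)

Section DiagonalTuples.
Variables (F : numClosedFieldType) (N n : nat).
Implicit Types (p : cpoly F N) (X Y : 'I_N -> 'M[F]_n).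

Definition diag_tuple X Y : 'I_N -> 'M[F]_(n + n) := fun i => block_mx (X i) 0 0 (Y i).

Definition diff_tuple X Y : 'I_N -> 'M[F]_(n + n) := fun i => block_mx 0 (X i - Y i) 0 0.

Lemma commuting_diag_tuple X Y : commuting X -> commuting Y ->
  commuting (diag_tuple X Y).
Proof.
move=> cX cY i j; rewrite /diag_tuple !mulmx_block.
by rewrite !mul0mx !mulmx0 !addr0 !add0r cX cY.
Qed.

(** The Leibniz rule for the commutator with [[0, 1], [0, 0]]. *)
Lemma diff_tuple_leibniz (A B C D : 'M[F]_n) :
  block_mx A 0 0 B *m block_mx 0 (C - D) 0 0 + block_mx 0 (A - B) 0 0 *m block_mx C 0 0 D
  = block_mx 0 (A *m C - B *m D) 0 0 :> 'M[F]_(n + n).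
Proof.
rewrite !mulmx_block !mul0mx !mulmx0 !addr0 !add0r add_block_mx !addr0.
by rewrite mulmxBr mulmxBl addrA addrNK.
Qed.

Lemma commuting_diff_tuple X Y : commuting X -> commuting Y ->
  commuting (blockT (diag_tuple X Y) (diff_tuple X Y)).
Proof.
move=> cX cY; apply: commuting_blockT; first exact: commuting_diag_tuple.
by move=> i j; rewrite !diff_tuple_leibniz cX cY.
Qed.

Lemma ceval_diff_tuple X Y p :
  ceval p (blockT (diag_tuple X Y) (diff_tuple X Y)) =
    block_mx (block_mx (ceval p X) 0 0 (ceval p Y))
             (block_mx 0 (ceval p X - ceval p Y) 0 0) 0
             (block_mx (ceval p X) 0 0 (ceval p Y)).
Proof.
elim: p => [i|c|p pE q qE|p pE q qE] //=; rewrite ?pE ?qE.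
- by rewrite subrr block_mx0 -!scalar_mx_block.
- by rewrite !add_block_mx !addr0 opprD addrACA.
rewrite [LHS]mulmx_block !mul0mx !mulmx0 !addr0 !add0r diff_tuple_leibniz.
by rewrite !mulmx_block !mul0mx !mulmx0 !addr0 !add0r.
Qed.

End DiagonalTuples.

(** * The cycle of implications *)

Unset Implicit Arguments.

Theorem mainTheorem4 (F : numClosedFieldType) (N : nat)
  (P : 'I_N -> cpoly F N) :
  [<->
   (* (1) DP(X)[H] = 0 implies H = 0 *)
   (forall (n : nat) (X H : 'I_N -> 'M[F]_n),
      commuting X -> commuting (blockT X H) ->
      (forall j, DP P X H j = 0) -> forall i, H i = 0);
   (* (2) P is injective on C *)
   (forall (n : nat) (X Y : 'I_N -> 'M[F]_n),
      commuting X -> commuting Y ->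
      (forall j, polymap P X j = polymap P Y j) -> forall i, X i = Y i);
   (* (3) P is a bijection of C onto itself *)
   ((forall (n : nat) (X : 'I_N -> 'M[F]_n),
       commuting X -> commuting (polymap P X)) /\
    (forall (n : nat) (X Y : 'I_N -> 'M[F]_n),
      commuting X -> commuting Y ->
      (forall j, polymap P X j = polymap P Y j) -> forall i, X i = Y i) /\
    (forall (n : nat) (Y : 'I_N -> 'M[F]_n),
      commuting Y ->
      exists X : 'I_N -> 'M[F]_n, commuting X /\ forall j, polymap P X j = Y j));
   (* (4) P^{-1} exists on C and is given by a polynomial map Q *)
   (exists Q : 'I_N -> cpoly F N,
      forall (n : nat) (X : 'I_N -> 'M[F]_n), commuting X ->
        (forall i, polymap Q (polymap P X) i = X i) /\
        (forall i, polymap P (polymap Q X) i = X i))].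
Proof.
tfae.
- move=> P1 n X Y cX cY PXY i; apply/eqP; rewrite -subr_eq0; apply/eqP.
  have := P1 _ _ _ (commuting_diag_tuple cX cY) (commuting_diff_tuple cX cY).
  move=> /(_ _ i) D0; have /D0 : forall j, DP P (diag_tuple X Y) (diff_tuple X Y) j = 0.
    move=> j; rewrite /DP /polymap ceval_diff_tuple block_mxKur.
    by rewrite [ceval _ X]PXY subrr block_mx0.
  by move/(congr1 ursubmx); rewrite block_mxKur => ->; apply/matrixP => a b; rewrite !mxE.
(* Surjectivity comes from the polynomial inverse: [polymap Q Y] is a commuting preimage of [Y]. *)
- move=> P_inj; have [Q QP] := polynomial_inverse P_inj.
  split; first by move=> n X cX i j; apply: commuting_ceval.
  split=> // n Y cY; exists (polymap Q Y); split; last exact: (QP n Y cY).2.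
  by move=> i j; apply: commuting_ceval.
- by move=> [_ [P_inj _]]; apply: polynomial_inverse.
move=> [Q QP] n X H cX cXH DP0 i.
(* A vanishing derivative says that the two block tuples have the same image; [Q] recovers each from
   it, so they coincide. *)
have PE j : polymap P (blockT X H) j = polymap P (blockT X (fun=> 0)) j.
  by rewrite /polymap ceval_blockT ceval_blockT0 [ursubmx _]DP0.
have [+ _] := QP _ _ cXH; move/(_ i).
have cX0 : commuting (blockT X (fun=> 0)).
  by apply: commuting_blockT => // k l; rewrite !mulmx0 !mul0mx.
have [+ _] := QP _ _ cX0; move/(_ i).
have -> : polymap Q (polymap P (blockT X H)) i
        = polymap Q (polymap P (blockT X (fun=> 0))) i.
  rewrite /polymap; elim: (Q i) => [j|c|p IHp q IHq|p IHp q IHq] //=.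
  - exact: PE.
  - by rewrite IHp IHq.
  by rewrite IHp IHq.
by move=> -> /(congr1 ursubmx); rewrite !block_mxKur.
Qed.
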